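(* Let $K$ be a complete discretely valued field of odd residue characteristic $p$, with valuation ring $\mathcal O_K$ and uniformiser $\pi$. Let $E_1/K: y^2=c_1f_1(x)$ and $E_2/K: y^2=c_2f_2(x)$ be elliptic curves with $c_1,c_2\in K^\times$ and $f_1,f_2\in\mathcal O_K[x]$ monic polynomials of degree $3$. Let $\mathcal R_1\subset\overline K$ denote the set of roots of $f_1$, and put $$d=\max_{r\ne s\in\mathcal R_1}v(r-s),\qquad e=\max_{r\in\mathcal R_1}v(f_1'(r)),$$ where $f_1'$ is the derivative of $f_1$. Suppose that $c_1/c_2\in K^{\times 2}$ and $f_1\equiv f_2\pmod{\pi^N\mathcal O_K[x]}$ for some integer $N>d+e$. Then $T_2E_1\cong T_2E_2$ as $\mathbb Z_2[G_K]$-modules.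
   Context: $\overline K$ is an algebraic closure of $K$, $v$ is the extension of the valuation of $K$ to $\overline K$, normalised by $v(\pi)=1$. $G_K$ is the absolute Galois group of $K$. $K^{\times 2}$ denotes the group of squares in $K^\times$. $T_2E=\varprojlim_n E[2^n]$ is the integral $2$-adic Tate module with its natural $G_K$-action. *)

(* Defs.v *)
From HB Require Import structures.
From mathcomp Require Import all_boot all_order all_algebra.
From mathcomp Require Import classical_sets functions constructive_ereal.

Set Implicit Arguments.
Unset Strict Implicit.
Unset Printing Implicit Defensive.

Import Order.TTheory GRing.Theory Num.Theory.
Local Open Scope ring_scope.

(** * Valued fields *)

Record valuation (F : fieldType) (R : realDomainType) (v : F -> \bar R) : Prop :=
  Valuation {
    val0 : v 0 = +oo%E;
    val_fin : forall x, x != 0 -> v x \is a fin_num;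
    valM : forall x y, v (x * y) = (v x + v y)%E;
    valD : forall x y, (Order.min (v x) (v y) <= v (x + y)%R)%E }.

Definition valuation_ring (F : fieldType) (R : realDomainType) (v : F -> \bar R)
  : {pred F} := [pred x | (0 <= v x)%E].

Definition cauchy_seq (F : fieldType) (v : F -> \bar int) (u : nat -> F) : Prop :=
  forall B : int, exists M : nat, forall i j : nat,
    (M <= i)%N -> (M <= j)%N -> (B%:E <= v (u i - u j)%R)%E.

Definition limit_seq (F : fieldType) (v : F -> \bar int) (u : nat -> F) (l : F)
  : Prop :=
  forall B : int, exists M : nat, forall i : nat,
    (M <= i)%N -> (B%:E <= v (u i - l)%R)%E.

Definition complete_for (F : fieldType) (v : F -> \bar int) : Prop :=
  forall u : nat -> F, cauchy_seq v u -> exists l : F, limit_seq v u l.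

(* [v] is the normalised valuation, with value group exactly Z. *)
Record complete_discrete_valuation (K : fieldType) (v : K -> \bar int) (pi : K)
  : Prop := CompleteDiscreteValuation {
    cdv_valuation : valuation v;
    cdv_uniformiser : v pi = 1%:E;
    cdv_complete : complete_for v }.

(* The image of [p] in the residue field O / m vanishes iff [0 < v p]. *)
Definition residue_char (K : fieldType) (v : K -> \bar int) (p : nat) : Prop :=
  prime p /\ (0 < v p%:R%R)%E.

Definition congr_poly (K : fieldType) (v : K -> \bar int) (a : K) (f g : {poly K})
  : Prop :=
  exists2 h : {poly K}, h \is a polyOver (valuation_ring v) & f - g = a *: h.

(** * Algebraic closure and absolute Galois group *)

Definition algebraic_closure (K : fieldType) (L : closedFieldType)
    (iota : {rmorphism K -> L}) : Prop :=
  forall x : L, algebraicOver iota x.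

(* The value group of the algebraic closure is Q, whence the codomain of [w]. *)
Record extends_valuation (K L : fieldType) (iota : {rmorphism K -> L})
    (v : K -> \bar int) (w : L -> \bar rat) : Prop := ExtendsValuation {
  ext_valuation : valuation w;
  ext_restrict : forall x : K, w (iota x) = er_map intr (v x) }.

(* Automorphisms of the algebraic closure L over K. When K is imperfect,
   restriction identifies this group with the Galois group of the separable
   closure of K in L. *)
Record absolute_galois (K L : fieldType) (iota : {rmorphism K -> L}) :=
  AbsoluteGalois {
    gal_fun :> {rmorphism L -> L};
    gal_bij : bijective gal_fun;
    gal_fix : forall x : K, gal_fun (iota x) = iota x }.

(** * Roots of polynomials *)

Definition root_seq (L : closedFieldType) (f : {poly L}) : seq L :=
  undup (sval (closed_field_poly_normal f)).

Lemma mem_roots (L : closedFieldType) (f : {poly L}) (x : L) :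
  f != 0 -> (x \in root_seq f) = root f x.
Proof.
move=> f0; rewrite mem_undup; case: closed_field_poly_normal => s /= ->.
by rewrite rootZ ?lead_coef_eq0 // root_prod_XsubC.
Qed.

Definition max_root_dist (L : closedFieldType) (w : L -> \bar rat) (f : {poly L})
  : \bar rat :=
  \big[Order.max/-oo%E]_(r <- root_seq f)
    \big[Order.max/-oo%E]_(s <- root_seq f | r != s) w (r - s).

Definition max_deriv_val (L : closedFieldType) (w : L -> \bar rat) (f : {poly L})
  : \bar rat :=
  \big[Order.max/-oo%E]_(r <- root_seq f) w f^`().[r].

(** * Elliptic curves y^2 = g(x), with g a cubic *)

(* Nonsingularity is the Jacobian criterion for y^2 - g(x) at geometric points;
   the point at infinity of such a cubic is always nonsingular. *)
Definition elliptic (L : closedFieldType) (g : {poly L}) : Prop :=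
  size g = 4%N /\
  forall x y : L, y ^+ 2 = g.[x] -> ~ (y *+ 2 = 0 /\ g^`().[x] = 0).

Inductive ec_point (L : Type) := Infinity | Affine of L & L.
Arguments Infinity {L}.

Section GroupLaw.
Variables (L : fieldType) (g : {poly L}).

Definition on_curve (P : ec_point L) : Prop :=
  if P is Affine x y then y ^+ 2 = g.[x] else True.

(* Third intersection point of the curve with the line of slope [l] through
   (x1, y1) and an intersection point of abscissa x2, reflected in the x-axis:
   x1 + x2 + x3 is read off the coefficients of g(x) - (l * (x - x1) + y1)^2. *)
Definition chord (l x1 y1 x2 : L) : ec_point L :=
  let x3 := (l ^+ 2 - g`_2) / g`_3 - x1 - x2 in
  Affine x3 (- (y1 + l * (x3 - x1))).

Definition add_point (P Q : ec_point L) : ec_point L :=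
  match P, Q with
  | Infinity, _ => Q
  | _, Infinity => P
  | Affine x1 y1, Affine x2 y2 =>
      if x1 != x2 then chord ((y2 - y1) / (x2 - x1)) x1 y1 x2
      else if y1 == - y2 then Infinity
      else chord (g^`().[x1] / (y1 *+ 2)) x1 y1 x1
  end.

Definition mul_point (n : nat) (P : ec_point L) : ec_point L :=
  iter n (add_point P) Infinity.

End GroupLaw.

Definition map_point (L M : Type) (s : L -> M) (P : ec_point L) : ec_point M :=
  if P is Affine x y then Affine (s x) (s y) else Infinity.

(** * Two-adic integers and Tate modules *)

(* The inverse limit of the Z/2^n, residues being given by their representatives
   in [0, 2^n). *)
Record two_adic := TwoAdic {
  residue :> forall n : nat, 'I_(2 ^ n);
  residue_compat : forall n, residue n.+1 = residue n %[mod 2 ^ n] }.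

(* The Tate module is a subset of the sequences of points, on which the module
   operations are defined termwise. *)
Section Tate.
Variables (L : fieldType) (g : {poly L}).

Definition torsion (m : nat) : set (ec_point L) :=
  [set P | on_curve g P /\ mul_point g m P = Infinity].

Definition tate2 : set (nat -> ec_point L) :=
  [set P | forall n, torsion (2 ^ n) (P n) /\ mul_point g 2 (P n.+1) = P n].

Definition tate_add (P Q : nat -> ec_point L) : nat -> ec_point L :=
  fun n => add_point g (P n) (Q n).

Definition tate_scale (z : two_adic) (P : nat -> ec_point L) : nat -> ec_point L :=
  fun n => mul_point g (z n) (P n).

Definition tate_act (K : fieldType) (iota : {rmorphism K -> L})
    (s : absolute_galois iota) (P : nat -> ec_point L) : nat -> ec_point L :=
  fun n => map_point s (P n).

End Tate.

(* Isomorphism of Z_2[G_K]-modules between the Tate modules of y^2 = g1(x) and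
   y^2 = g2(x); the values of [phi] outside [tate2 g1] are irrelevant. *)
Definition tate2_isomorphic (K L : fieldType) (iota : {rmorphism K -> L})
    (g1 g2 : {poly L}) : Prop :=
  exists phi : (nat -> ec_point L) -> (nat -> ec_point L),
    [/\ set_bij (tate2 g1) (tate2 g2) phi,
        forall P Q, tate2 g1 P -> tate2 g1 Q ->
          phi (tate_add g1 P Q) = tate_add g2 (phi P) (phi Q),
        forall z P, tate2 g1 P ->
          phi (tate_scale g1 z P) = tate_scale g2 z (phi P)
      & forall (s : absolute_galois iota) P, tate2 g1 P ->
          phi (tate_act s P) = tate_act s (phi P)].

(* Main.v *)
(* Call x and y near when x / y is a principal unit (or x = y = 0). A Krasner-type
   estimate pairs the roots a_i of f1 with roots b_i of f2, equivariantly under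
   Galois, such that a_i - a_j is near b_i - b_j. This relation propagates under
   halving: a half of a point of abscissa x is given by square roots r_i of the
   x - a_i, with abscissa a_i + (r_i + r_j) (r_i + r_k). If r_i, r_j are near
   r_i', r_j', then so are r_i + r_j and r_i' + r_j': since 2 is a unit, one of
   r_i + r_j and r_i - r_j involves no cancellation, and their product is
   a_j - a_i. Hence every compatible sequence of 2^n-torsion points of E1 has a
   unique near compatible sequence on E2. That this bijection is additive follows
   from the same trick, applied to the addition formula expressed in the r_i of
   two points: the abscissa differences x(P) - x(Q) are inductively near x(P') - x(Q'),
   and the formula factors into r_i - s_i, their sums, and D +- (r_i - s_i)(r_j - s_j)
   with D = r_i^2 - s_i^2. Equivariance holds because completeness of K forces
   Galois to preserve the valuation. *)
Require Import Defs.
From mathcomp Require Import all_boot all_order all_algebra.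
From mathcomp Require Import boolp classical_sets functions constructive_ereal.
From mathcomp Require Import ring lra.
Set Implicit Arguments.
Unset Strict Implicit.
Unset Printing Implicit Defensive.
Import Order.TTheory GRing.Theory Num.Theory.
Local Open Scope ring_scope.
#[local] Arguments add_point : simpl never.

(** * Cubics and halving *)

(** The obstacle is uniformity in n: one bound N has to serve the torsion of every level. This is
    why errors are relative: a principal unit has a principal square root and 2 is a unit, so
    halving costs nothing. The price is that nearness is multiplicative and does not pass to sums,
    so every quantity must first be written as a product of factors already known to be near; this
    is what the parametrisations by r_i, u_i and D provide. The bound N > d + e enters only through
    the roots. If no root z of f2 satisfied v(r - z) > d for a root r of f1, each product of two
    factors r - z_i would have valuation at least N - d, hence so would f1'(r), against e < N - d.
    Once v(a_i - b_i) > d, the error a_i - b_i is negligible against all differences of roots of f1.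
    The square roots k, k' of c1, c2 may lie outside K, but k / k' lies in K: Galois changes their
    signs simultaneously. This is why y / k, and not y, is compared. *)

Section Cubic.
Variables (L : fieldType) (k a1 a2 a3 : L).

(** With the leading coefficient written as a square, the ordinates in the halving formulas are
    polynomials in k and the r_i. *)
Definition cubic : {poly L} :=
  (k ^+ 2) *: (('X - a1%:P) * ('X - a2%:P) * ('X - a3%:P)).

Lemma cubicE x : cubic.[x] = k ^+ 2 * ((x - a1) * (x - a2) * (x - a3)).
Proof. by rewrite !hornerE. Qed.

Lemma cubic_deriv x : cubic^`().[x] =
  k ^+ 2 * ((x - a1) * (x - a2) + (x - a1) * (x - a3) + (x - a2) * (x - a3)).
Proof.
rewrite /cubic derivZ !derivM !derivXsubC !mulr1 !mul1r.
by rewrite !(hornerXsubC, hornerZ, hornerM, hornerD); ring.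
Qed.

Lemma cubic_poly : cubic = Poly [:: - k ^+ 2 * (a1 * a2 * a3);
   k ^+ 2 * (a1 * a2 + a1 * a3 + a2 * a3); - k ^+ 2 * (a1 + a2 + a3); k ^+ 2].
Proof.
rewrite /cubic /= !cons_poly_def mul0r add0r -mul_polyC !(polyCM, polyCN, polyCD).
ring.
Qed.

Lemma cubic2 : cubic`_2 = - k ^+ 2 * (a1 + a2 + a3).
Proof. by rewrite cubic_poly coef_Poly. Qed.

Lemma cubic3 : cubic`_3 = k ^+ 2.
Proof. by rewrite cubic_poly coef_Poly. Qed.
End Cubic.

Definition opp_point (L : fieldType) (P : ec_point L) :=
  if P is Affine x y then Affine x (- y) else Infinity.

Section Param.
Variables (L : fieldType) (k : L).
Hypotheses (k0 : k != 0) (two0 : (2 : L) != 0).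

(* On y^2 = k^2 (x - x0 + r1^2) (x - x0 + r2^2) (x - x0 + r3^2), [double_pt] is a
   point of abscissa x0 and [half_pt] a half of it: the classical halving
   formulas, with r1, r2, r3 square roots of the x0 - a_i. *)
Definition half_pt r1 r2 r3 (x0 : L) : ec_point L :=
  Affine (x0 + r1 * r2 + r1 * r3 + r2 * r3)
         (k * ((r1 + r2) * (r1 + r3) * (r2 + r3))).

Definition double_pt r1 r2 r3 (x0 : L) := Affine x0 (k * (r1 * r2 * r3)).

Definition half_cubic r1 r2 r3 (x0 : L) :=
  cubic k (x0 - r1 ^+ 2) (x0 - r2 ^+ 2) (x0 - r3 ^+ 2).

Lemma pt_dbl r1 r2 r3 x0 : r1 + r2 != 0 -> r1 + r3 != 0 -> r2 + r3 != 0 ->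
  add_point (half_cubic r1 r2 r3 x0) (half_pt r1 r2 r3 x0) (half_pt r1 r2 r3 x0) =
  double_pt r1 r2 r3 x0.
Proof.
move=> h12 h13 h23; rewrite /add_point /= eqxx /=.
rewrite ifF; last first.
  by apply/negP; rewrite -addr_eq0 -mulr2n -mulr_natr !mulf_eq0 (negPf k0)
    (negPf two0) (negPf h12) (negPf h13) (negPf h23).
rewrite /chord /half_cubic cubic_deriv cubic2 cubic3 /double_pt.
rewrite -[_ *+ 2]mulr_natl.
congr Affine; field; by rewrite k0 two0 h12 h13 h23.
Qed.

(** The halves of a point correspond to the sign changes of r1, r2, r3 that preserve r1 r2 r3;
    translation by (a1, 0) is the change that fixes r1. *)
Lemma crv_add_T1 r1 r2 r3 x0 : r1 + r2 != 0 -> r1 + r3 != 0 ->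
  add_point (half_cubic r1 r2 r3 x0) (half_pt r1 r2 r3 x0) (Affine (x0 - r1 ^+ 2) 0) =
  half_pt r1 (- r2) (- r3) x0.
Proof.
move=> h12 h13.
have n : x0 - r1 ^+ 2 - (x0 + r1 * r2 + r1 * r3 + r2 * r3) =
  - ((r1 + r2) * (r1 + r3)) by ring.
rewrite /add_point /= ifT; last first.
  by rewrite eq_sym -subr_eq0 n oppr_eq0 mulf_neq0.
rewrite /chord /half_cubic cubic2 cubic3 sub0r n.
by congr Affine; field; rewrite k0 oppr_eq0 mulf_neq0.
Qed.

Lemma cubicC12 a1 a2 a3 : cubic k a1 a2 a3 = cubic k a2 a1 a3.
Proof. by rewrite /cubic [_ * ('X - a2%:P)]mulrC. Qed.

Lemma cubicC23 a1 a2 a3 : cubic k a1 a2 a3 = cubic k a1 a3 a2.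
Proof. by rewrite /cubic mulrAC. Qed.

Lemma ptC12 r1 r2 r3 x0 : half_pt r1 r2 r3 x0 = half_pt r2 r1 r3 x0.
Proof. by rewrite /half_pt; congr Affine; ring. Qed.

Lemma ptC23 r1 r2 r3 x0 : half_pt r1 r2 r3 x0 = half_pt r1 r3 r2 x0.
Proof. by rewrite /half_pt; congr Affine; ring. Qed.

Variables (u1 u2 u3 D x0 : L).
Hypotheses (nu1 : u1 != 0) (nu2 : u2 != 0) (nu3 : u3 != 0) (nD : D != 0).
Hypotheses (n12 : u1 + u2 != 0) (n13 : u1 + u3 != 0) (n23 : u2 + u3 != 0).
(* Two points whose doubles have distinct abscissas, together with the curve, are
   parametrised rationally by u_i = r_i - s_i and D = r_i^2 - s_i^2. *)
Let r u := (D / u + u) / 2.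
Let s u := (D / u - u) / 2.
(** The line through the two doubles takes at a_i the value - k r_i s_i t_i. As the product of the
    three x_j - a_i over its intersections with the curve is the square of this value over k, the
    sum of the doubles has abscissa a_i + t_i^2. *)
Let t a b c := (r b * r c * s a - s b * s c * r a) / D.

Lemma pt_add :
  add_point (half_cubic (r u1) (r u2) (r u3) x0)
    (half_pt (r u1) (r u2) (r u3) x0) (half_pt (s u1) (s u2) (s u3) (x0 - D)) =
  half_pt (t u1 u2 u3) (t u2 u1 u3) (t u3 u1 u2)
   (x0 - r u1 ^+ 2 + t u1 u2 u3 ^+ 2).
Proof.
have e : (x0 - D) + s u1 * s u2 + s u1 * s u3 + s u2 * s u3
   - (x0 + r u1 * r u2 + r u1 * r u3 + r u2 * r u3)
  = - D * ((u1 + u2) * (u1 + u3) * (u2 + u3)) / (2 * u1 * u2 * u3).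
  rewrite /r /s; field; by rewrite nu1 nu2 nu3 two0.
rewrite /add_point /= ifT; last first.
  rewrite eq_sym -subr_eq0 e !(mulf_eq0,invr_eq0,oppr_eq0).
  by rewrite (negPf nD) (negPf nu1) (negPf nu2) (negPf nu3) (negPf n12)
    (negPf n13) (negPf n23) (negPf two0).
rewrite e /chord /half_cubic cubic2 cubic3.
by congr Affine; rewrite /t /r /s; field;
  rewrite ?k0 ?two0 ?nu1 ?nu2 ?nu3 ?n12 ?n13 ?n23 ?oppr_eq0 ?nD.
Qed.

Lemma dpt_add :
  add_point (half_cubic (r u1) (r u2) (r u3) x0)
    (double_pt (r u1) (r u2) (r u3) x0) (double_pt (s u1) (s u2) (s u3) (x0 - D)) =
  double_pt (t u1 u2 u3) (t u2 u1 u3) (t u3 u1 u2)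
   (x0 - r u1 ^+ 2 + t u1 u2 u3 ^+ 2).
Proof.
have e : (x0 - D) - x0 = - D by ring.
rewrite /add_point /= ifT; last first.
  by rewrite eq_sym -subr_eq0 e oppr_eq0.
rewrite e /chord /half_cubic cubic2 cubic3.
by congr Affine; rewrite /t /r /s; field;
  rewrite ?k0 ?two0 ?nu1 ?nu2 ?nu3 ?n12 ?n13 ?n23 ?oppr_eq0 ?nD.
Qed.
End Param.

(** * The group law *)

Section GroupLaw.
Variables (L : fieldType) (g : {poly L}).
Hypotheses (two0 : (2 : L) != 0) (size_g : size g = 4%N).
Hypothesis g_smooth : forall x, g.[x] = 0 -> g^`().[x] != 0.
Local Notation "P +e Q" := (add_point g P Q) (at level 50, left associativity).
Local Notation c := g`_3.
Local Notation b := g`_2.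
Local Notation on := (on_curve g).

Lemma cubic_lead_neq0 : c != 0.
Proof.
have : lead_coef g != 0 by rewrite lead_coef_eq0 -size_poly_eq0 size_g.
by rewrite lead_coefE size_g.
Qed.
Let c0 := cubic_lead_neq0.

Lemma cubic_horner x : g.[x] = g`_0 + g`_1 * x + b * x ^+ 2 + c * x ^+ 3.
Proof.
by rewrite horner_coef size_g !big_ord_recl big_ord0 /= /bump /=; ring.
Qed.

Lemma cubic_horner_deriv x : g^`().[x] = g`_1 + 2 * b * x + 3 * c * x ^+ 2.
Proof.
rewrite (@horner_coef_wide _ 3); last first.
  by rewrite (leq_trans (size_poly _ _)) ?size_g.
rewrite !big_ord_recl big_ord0 /= /bump /= !coef_deriv /=.
rewrite -[g`_2 *+ _]mulr_natl -[g`_3 *+ _]mulr_natl -[g`_1 *+ _]mulr_natl; ring.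
Qed.

Lemma on_affine x y : on (Affine x y) <->
  y ^+ 2 = g`_0 + g`_1 * x + b * x ^+ 2 + c * x ^+ 3.
Proof. by rewrite /on_curve cubic_horner. Qed.

Lemma add_chord x1 y1 x2 y2 : x1 != x2 ->
  Affine x1 y1 +e Affine x2 y2 = chord g ((y2 - y1) / (x2 - x1)) x1 y1 x2.
Proof. by move=> h; rewrite /add_point h. Qed.

Lemma add_tangent x y : y != 0 ->
  Affine x y +e Affine x y = chord g (g^`().[x] / (2 * y)) x y x.
Proof.
move=> h; rewrite /add_point eqxx /= [y *+ 2]mulr2n ifF; last first.
  by rewrite -addr_eq0 -mulr2n -mulr_natl mulf_eq0 (negPf h) (negPf two0).
by rewrite mulr_natl mulr2n.
Qed.

Lemma add_pt_opp x y : Affine x y +e Affine x (- y) = Infinity.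
Proof. by rewrite /add_point eqxx /= opprK eqxx. Qed.

Lemma add_opp_pt x y : Affine x (- y) +e Affine x y = Infinity.
Proof. by rewrite /add_point !eqxx. Qed.

Lemma add_pt0 x : Affine x 0 +e Affine x 0 = Infinity.
Proof. by rewrite /add_point oppr0 !eqxx. Qed.

Lemma on_same_x x y1 y2 : on (Affine x y1) -> on (Affine x y2) ->
  y1 = y2 \/ y1 = - y2.
Proof.
rewrite /on_curve => <- /eqP; rewrite eqf_sqr.
by case/orP=> /eqP ->; rewrite ?opprK; [left|right].
Qed.

Lemma on_opp P : on P -> on (opp_point P).
Proof. by case: P => //= x y; rewrite sqrrN. Qed.

Lemma opp_pointK P : opp_point (opp_point P) = P :> ec_point L.
Proof. by case: P => //= x y; rewrite opprK. Qed.

Lemma add_opp P : P +e opp_point P = Infinity.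
Proof. by case: P => //= x y; apply: add_pt_opp. Qed.

Lemma add_point0 P : P +e Infinity = P.
Proof. by case: P. Qed.

Lemma add_pointC P Q : on P -> on Q -> P +e Q = Q +e P.
Proof.
case: P Q => [|x1 y1] [|x2 y2] // oP oQ.
have [e|ne] := eqVneq x1 x2; last first.
  rewrite (add_chord _ _ ne) add_chord 1?eq_sym // /chord.
  have n1 : x2 - x1 != 0 by rewrite subr_eq0 eq_sym.
  have n2 : x1 - x2 != 0 by rewrite subr_eq0.
  by congr Affine; field; rewrite ?c0 ?n1 ?n2.
rewrite e in oP *.
by have [->|->] := on_same_x oP oQ; rewrite // add_pt_opp add_opp_pt.
Qed.

Lemma opp_point_add P Q :
  on P -> on Q -> opp_point P +e opp_point Q = opp_point (P +e Q).
Proof.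
case: P Q => [|x1 y1] [|x2 y2] // oP oQ.
have [e|ne] := eqVneq x1 x2; last first.
  rewrite !add_chord // /chord /=.
  have n1 : x2 - x1 != 0 by rewrite subr_eq0 eq_sym.
  by congr Affine; field; rewrite ?c0 ?n1.
rewrite e in oP *.
have [->|->] := on_same_x oP oQ; last first.
  by rewrite /= opprK add_pt_opp add_opp_pt.
have [->|y0] := eqVneq y2 0; first by rewrite /= oppr0 add_pt0.
rewrite /= !add_tangent ?oppr_eq0 // /chord /=.
by congr Affine; field; rewrite ?c0 ?two0 ?oppr_eq0 ?y0.
Qed.

Lemma on_chord l x1 y1 x2 : on (Affine x1 y1) ->
  (forall x, g.[x] - (l * (x - x1) + y1) ^+ 2 =
     c * (x - x1) * (x - x2) * (x - ((l ^+ 2 - b) / c - x1 - x2))) ->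
  on (chord g l x1 y1 x2).
Proof.
move=> o1 h; rewrite /chord /on_curve; set x3 := (_ / _ - _ - _).
have := h x3; rewrite -/x3 subrr mulr0 => /eqP; rewrite subr_eq0 => /eqP ->.
by rewrite sqrrN addrC.
Qed.

(** Solving the curve equations for the coefficients of g, here and in the similar lemmas for
    [g]_0[and]g[_2], leaves free variables and turns claims about points into identities for
    [field]. *)
Lemma coef1_chord x1 y1 x2 y2 : x1 != x2 -> on (Affine x1 y1) -> on (Affine x2 y2) ->
  g`_1 = (y2 ^+ 2 - y1 ^+ 2) / (x2 - x1) - b * (x1 + x2)
         - c * (x1 ^+ 2 + x1 * x2 + x2 ^+ 2).
Proof.
move=> ne /on_affine o1 /on_affine o2.
have n1 : x2 - x1 != 0 by rewrite subr_eq0 eq_sym.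
by rewrite o1 o2; field.
Qed.

Lemma coef0_on x y : on (Affine x y) ->
  g`_0 = y ^+ 2 - g`_1 * x - b * x ^+ 2 - c * x ^+ 3.
Proof. by move=> /on_affine ->; ring. Qed.

Lemma on_add P Q : on P -> on Q -> on (P +e Q).
Proof.
case: P Q => [|x1 y1] [|x2 y2] // oP oQ.
have [e|ne] := eqVneq x1 x2; last first.
  have n1 : x2 - x1 != 0 by rewrite subr_eq0 eq_sym.
  rewrite add_chord //; apply: on_chord => // x.
  rewrite cubic_horner (coef0_on oP) (coef1_chord ne oP oQ).
  by field; rewrite c0 n1.
rewrite e in oP *.
have [->|->] := on_same_x oP oQ; last by rewrite add_opp_pt.
have [->|y0] := eqVneq y2 0; first by rewrite add_pt0.
rewrite add_tangent //; apply: on_chord => // x.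
rewrite cubic_horner cubic_horner_deriv (coef0_on oQ).
by field; rewrite c0 two0 y0.
Qed.

Lemma coef2_third l x1 x2 x3 : x3 = (l ^+ 2 - b) / c - x1 - x2 ->
  b = l ^+ 2 - c * (x1 + x2 + x3).
Proof. by move=> ->; field. Qed.

(** The line through P and Q is also the line through -(P + Q) and Q, up to reflection. The delicate
    case is P + Q = -Q, where the second addition uses a tangent although the first used a chord. *)
Lemma addK P Q : on P -> on Q -> (P +e Q) +e opp_point Q = P.
Proof.
case: P => [|x1 y1] oP oQ; first by rewrite /= add_opp.
case: Q oQ => [|x2 y2] oQ //=.
have [e|ne] := eqVneq x1 x2; last first.
  have n1 : x2 - x1 != 0 by rewrite subr_eq0 eq_sym.
  have n2 : x1 - x2 != 0 by rewrite subr_eq0.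
  have oS := on_add oP oQ.
  move: oS; rewrite add_chord // /chord.
  set l := (_ / (x2 - x1)); set x3 := (_ / c - _ - _); set y3 := - (_ + _) => oS.
  have eb := coef2_third (erefl x3).
  have ey2 : y2 = y1 + l * (x2 - x1) by rewrite /l; field.
  have [e3|n3] := eqVneq x3 x2; last first.
    rewrite add_chord // /chord eb.
    have n31 : x3 - x2 != 0 by rewrite subr_eq0.
    have n32 : x2 - x3 != 0 by rewrite subr_eq0 eq_sym.
    have el : (- y2 - y3) / (x2 - x3) = - l.
      by rewrite /y3 ey2; field.
    rewrite el; have -> : ((- l) ^+ 2 - (l ^+ 2 - c * (x1 + x2 + x3))) / c - x3 - x2 = x1.
      by field.
    by congr Affine; rewrite /y3; ring.
  have e3y : y3 = - y2 by rewrite /y3 e3 ey2.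
  have e1 := coef1_chord ne oP oQ.
  (* The chord meets the curve twice at Q, so it is the tangent there; for y2 = 0 this would make Q
     a singular point. *)
  have : g^`().[x2] = 2 * l * y2.
    rewrite cubic_horner_deriv e1 eb e3 ey2; field; exact: n1.
  rewrite e3 e3y; have [y0|y0] := eqVneq y2 0.
    move: oQ; rewrite y0 /on_curve expr0n /= => /esym /g_smooth /eqP n0.
    by rewrite mulr0.
  move=> ed; rewrite add_tangent ?oppr_eq0 // /chord ed eb e3.
  have -> : 2 * l * y2 / (2 * - y2) = - l.
    by field; rewrite two0 oppr_eq0 y0.
  have -> : ((- l) ^+ 2 - (l ^+ 2 - c * (x1 + x2 + x2))) / c - x2 - x2 = x1 by field.
  by congr Affine; rewrite ey2; ring.
rewrite e in oP *.
have [->|->] := on_same_x oP oQ; last by rewrite add_opp_pt.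
have [->|y0] := eqVneq y2 0; first by rewrite add_pt0 oppr0.
move: (on_add oQ oQ); rewrite add_tangent // /chord.
set l := (_ / (2 * y2)); set x3 := (_ / c - _ - _); set y3 := - (_ + _) => oS.
have eb := coef2_third (erefl x3).
have [e3|n3] := eqVneq x3 x2; last first.
  rewrite add_chord // /chord eb.
  have n31 : x3 - x2 != 0 by rewrite subr_eq0.
  have n32 : x2 - x3 != 0 by rewrite subr_eq0 eq_sym.
  have -> : (- y2 - y3) / (x2 - x3) = - l by rewrite /y3; field.
  have -> : ((- l) ^+ 2 - (l ^+ 2 - c * (x2 + x2 + x3))) / c - x3 - x2 = x2 by field.
  by congr Affine; rewrite /y3; ring.
have e3y : y3 = - y2 by rewrite /y3 e3; ring.
rewrite e3 e3y add_tangent ?oppr_eq0 // /chord.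
have -> : g^`().[x2] / (2 * - y2) = - l.
  by rewrite /l; field; rewrite two0 oppr_eq0 y0.
rewrite sqrrN -/x3 e3; congr Affine; ring.
Qed.

(* Together with [dbl_add] below, this is all the associativity needed to relate
   multiplication by 2^n to n-fold doubling. *)
Lemma addAl P X : on P -> on X -> P +e (P +e X) = (P +e P) +e X.
Proof.
case: P => [|x1 y1] oP oX //.
case: X oX => [|x2 y2] oX; first by rewrite !add_point0.
have oPP := on_add oP oP; have oPX := on_add oP oX.
have oNP := on_opp oP.
have [e|ne] := eqVneq x1 x2.
  move: oX oPX; rewrite -{}e => oX oPX; have [<-|e] := on_same_x oP oX.
    by rewrite [RHS]add_pointC.
  have -> : Affine x1 y2 = opp_point (Affine x1 y1) by rewrite /= e opprK.
  by rewrite add_opp addK.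
have n1 : x2 - x1 != 0 by rewrite subr_eq0 eq_sym.
have eX : (Affine x1 y1 +e Affine x2 y2) +e opp_point (Affine x1 y1) = Affine x2 y2.
  by rewrite (add_pointC oP oX) addK.
(* If P + X = -P, then X = -(P + P) and both sides are [Infinity]. *)
have key : opp_point (Affine x1 y1) = (Affine x1 y1 +e Affine x2 y2) ->
   Affine x1 y1 +e (Affine x1 y1 +e Affine x2 y2) =
     (Affine x1 y1 +e Affine x1 y1) +e Affine x2 y2.
  move=> e; rewrite -e in eX *; rewrite add_opp -eX opp_point_add //.
  by rewrite add_opp.
have [y0|y0] := eqVneq y1 0.
  have eN : opp_point (Affine x1 y1) = Affine x1 y1 by rewrite /= y0 oppr0.
  by rewrite add_pointC // -{2}eN eX -{2}eN add_opp.
have e1 := coef1_chord ne oP oX.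
move: oPX key eX; rewrite add_chord // /chord.
set l := (_ / (x2 - x1)); set x3 := (_ / c - _ - _); set y3 := - (_ + _) => oS key eX.
have eb := coef2_third (erefl x3).
have [e3|n3] := eqVneq x3 x1.
  by apply: key; rewrite /= e3 /y3 e3; congr Affine; ring.
have n31 : x3 - x1 != 0 by rewrite subr_eq0.
case ePP: (Affine x1 y1 +e Affine x1 y1) oPP => [|x4 y4] oPP.
  by move: ePP; rewrite add_tangent.
have ey2 : y2 = y1 + l * (x2 - x1) by rewrite /l; field.
have [e4|n4] := eqVneq x4 x2; last first.
  move: ePP; rewrite add_tangent // /chord.
  set m := (_ / (2 * y1)) => -[e4 ey4].
  have em : m = l + c * (x1 - x2) * (x1 - x3) / (2 * y1).
    rewrite /m cubic_horner_deriv e1 ey2 eb; field.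
    by rewrite two0 y0.
  have n42 : x2 - x4 != 0 by rewrite subr_eq0 eq_sym.
  rewrite !add_chord // 1?eq_sym // /chord -ey4.
  (* The slopes m and l and y1 are rational in x1, x2, x3, x4, c and w = m - l,
     which are algebraically independent: the identity becomes a free one. *)
  pose w := c * (x1 - x2) * (x1 - x3) / (2 * y1).
  have n12 : x1 - x2 != 0 by rewrite subr_eq0.
  have n13 : x1 - x3 != 0 by rewrite subr_eq0 eq_sym.
  have w0 : w != 0.
    by rewrite !mulf_eq0 invr_eq0 mulf_eq0 (negPf c0) (negPf two0) (negPf y0)
      (negPf n12) (negPf n13).
  have ey1 : y1 = c * (x1 - x2) * (x1 - x3) / (2 * w).
    by rewrite /w; field; rewrite y0 two0 c0 n12 n13.
  have em' : m = l + w by rewrite em.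
  have el : l = (c * (x4 - x2 - x3 + x1) / w - w) / 2.
    rewrite -e4 eb em'; field; by rewrite two0 c0 w0.
  clearbody w l x3 m; clear e4 ey4 em e1 key eX oS.
  rewrite /y3 ey2 em' eb ey1 el.
  by congr Affine; field; rewrite ?c0 ?w0 ?two0 ?n42 ?n31.
rewrite ePP in key.
have key' : Affine x2 y2 = opp_point (Affine x4 y4) ->
   Affine x1 y1 +e Affine x3 y3 =  Affine x4 y4 +e Affine x2 y2.
  move=> e; apply: key.
  rewrite -[RHS](addK oS oNP) eX opp_pointK e.
  rewrite -{2}[Affine x1 y1]opp_pointK opp_point_add //.
  by rewrite -ePP addK.
rewrite e4 in ePP oPP n3 key' *; have [ey4|] := on_same_x oPP oX; last first.
  by move=> e5; apply: key'; rewrite /= e5 opprK.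
have [y20|y20] := eqVneq y2 0; first by apply: key'; rewrite /= ey4 y20 oppr0.
rewrite ey4 in ePP *.
(* Here P + P = X, so the right side is a tangent addition at X. Both the chord of slope l and the
   tangent at P of slope m compute y2, which makes y1 and y2, and then everything else, rational in
   x1, x2, c, l and m. *)
move: ePP; rewrite add_tangent // /chord; set m := (_ / (2 * y1)) => -[e4' ey2'].
have em : g^`().[x1] = 2 * y1 * m by rewrite /m; field; rewrite two0 y0.
have eb2 : b = m ^+ 2 - c * (x1 + x1 + x2) by apply: coef2_third.
have e1' : g`_1 = 2 * y1 * m - 2 * b * x1 - 3 * c * x1 ^+ 2.
  by rewrite -em cubic_horner_deriv; ring.
have ey2m : y2 = - (y1 + m * (x2 - x1)) by rewrite -ey2' e4'.
have ey1 : y1 = - (l + m) * (x2 - x1) / 2.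
  have -> : y1 = (y1 + l * (x2 - x1) - y2 + (y2 + (y1 - l * (x2 - x1)))) / 2 by field.
  by rewrite -ey2 subrr add0r {1}ey2m; field.
have ey2l : y2 = (l - m) * (x2 - x1) / 2 by rewrite ey2 ey1; field.
have ed : g^`().[x2] = 2 * m * (- y2) + c * (x2 - x1) ^+ 2.
  rewrite cubic_horner_deriv e1' eb2 ey2m; ring.
have e3 : x3 = x1 + (l ^+ 2 - m ^+ 2) / c.
  have -> : x3 = (l ^+ 2 - b) / c - x1 - x2 by rewrite eb; field.
  by rewrite eb2; field.
have nlm : (l - m) * (l + m) != 0.
  move: n31; rewrite e3 addrAC subrr add0r mulf_eq0 subr_sqr negb_or; by case/andP.
have nl : l - m != 0 by move: y20; apply: contraNneq => h; rewrite ey2l h !mul0r.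
have nlm' : l + m != 0 by move: nlm; rewrite mulf_eq0 negb_or => /andP[].
rewrite add_chord 1?eq_sym // add_tangent // /chord ed /y3 e3 eb2 ey2l ey1.
clearbody l m.
have n3' : x1 * c + (l ^+ 2 - m ^+ 2) + - x1 * c != 0.
  by rewrite addrAC mulNr subrr add0r subr_sqr.
by congr Affine; field; rewrite ?c0 ?two0 ?n1 ?nl ?n3'.
Qed.
End GroupLaw.

(** * Halves, translation by 2-torsion and additivity of doubling *)

Section Halving.
Variables (L : fieldType) (k a1 a2 a3 : L).
Hypotheses (k0 : k != 0) (two0 : (2 : L) != 0).
Hypotheses (a12 : a1 != a2) (a13 : a1 != a3) (a23 : a2 != a3).
Local Notation g := (cubic k a1 a2 a3).
Local Notation "P +e Q" := (add_point g P Q) (at level 50, left associativity).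
Local Notation on := (on_curve g).

Lemma size_cubic : size g = 4%N.
Proof.
rewrite size_scale ?expf_neq0 // -!mulrA.
rewrite size_Mmonic ?monicXsubC ?polyXsubC_eq0 ?mulf_neq0 ?polyXsubC_eq0 //; last first.
  by rewrite monicMl monicXsubC.
by rewrite size_Mmonic ?polyXsubC_eq0 ?monicXsubC ?size_XsubC // .
Qed.

Lemma cubic_smooth x : g.[x] = 0 -> g^`().[x] != 0.
Proof.
rewrite cubicE cubic_deriv => /eqP; rewrite !mulf_eq0 (negPf k0) /= !subr_eq0.
have d12 : a1 - a2 != 0 by rewrite subr_eq0.
have d13 : a1 - a3 != 0 by rewrite subr_eq0.
have d23 : a2 - a3 != 0 by rewrite subr_eq0.
have d21 : a2 - a1 != 0 by rewrite subr_eq0 eq_sym.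
have d31 : a3 - a1 != 0 by rewrite subr_eq0 eq_sym.
have d32 : a3 - a2 != 0 by rewrite subr_eq0 eq_sym.
by case/orP => [/orP[]|] /eqP ->; rewrite !subrr ?(mul0r, mulr0, addr0, add0r)
  !mulf_neq0 // expf_neq0.
Qed.

Let onD := on_add two0 size_cubic.
Let addC := add_pointC size_cubic.
Let eaddK := addK two0 size_cubic cubic_smooth.
Let eaddAl := addAl two0 size_cubic cubic_smooth.
Let oppD := opp_point_add two0 size_cubic.

Definition half_param r1 r2 r3 x0 :=
  [/\ a1 = x0 - r1 ^+ 2, a2 = x0 - r2 ^+ 2 & a3 = x0 - r3 ^+ 2].

Lemma half_param_crv r1 r2 r3 x0 : half_param r1 r2 r3 x0 ->
  half_cubic k r1 r2 r3 x0 = g.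
Proof. by rewrite /half_cubic => -[<- <- <-]. Qed.

Lemma half_param_neq r1 r2 r3 x0 : half_param r1 r2 r3 x0 ->
  [/\ r1 + r2 != 0, r1 + r3 != 0 & r2 + r3 != 0] /\
  [/\ r1 - r2 != 0, r1 - r3 != 0 & r2 - r3 != 0].
Proof.
have F a b u v : a = x0 - u ^+ 2 -> b = x0 - v ^+ 2 -> a != b ->
    u + v != 0 /\ u - v != 0.
  move=> ea eb; rewrite -subr_eq0; have -> : a - b = - ((u + v) * (u - v)).
    by rewrite ea eb; ring.
  by rewrite oppr_eq0 mulf_eq0 negb_or => /andP.
case=> e1 e2 e3.
by have [? ?] := F _ _ _ _ e1 e2 a12; have [? ?] := F _ _ _ _ e1 e3 a13;
  have [? ?] := F _ _ _ _ e2 e3 a23.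
Qed.

Lemma on_pt r1 r2 r3 x0 : half_param r1 r2 r3 x0 -> on (half_pt k r1 r2 r3 x0).
Proof. by move=> h; rewrite -(half_param_crv h) /= cubicE; ring. Qed.

(** The parameters r_i of the double are rational in the coordinates of the point, so no square root
    is extracted. *)
Lemma on_pt_exists x y : on (Affine x y) -> y != 0 ->
  exists r1 r2 r3 x0, half_param r1 r2 r3 x0 /\
    Affine x y = half_pt k r1 r2 r3 x0.
Proof.
rewrite /= cubicE => oP y0.
(* p_ij is r_i + r_j: the halving formulas give x - a_i = p_ij p_ik and y = k p12 p13 p23. *)
pose p12 := k * (x - a1) * (x - a2) / y; pose p13 := k * (x - a1) * (x - a3) / y.
pose p23 := k * (x - a2) * (x - a3) / y.
(* The factor g(x) / y^2 = 1 hands the curve equation to [field]. *)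
have ey z : z = k ^+ 2 * ((x - a1) * (x - a2) * (x - a3)) * z / y ^+ 2.
  by rewrite -oP mulrAC mulfV ?mul1r ?expf_neq0.
have e1 : a1 = x - p12 * p13.
  have -> : p12 * p13 = x - a1 by rewrite [RHS]ey /p12 /p13; field.
  by ring.
have e2 : a2 = x - p12 * p23.
  have -> : p12 * p23 = x - a2 by rewrite [RHS]ey /p12 /p23; field.
  by ring.
have e3 : a3 = x - p13 * p23.
  have -> : p13 * p23 = x - a3 by rewrite [RHS]ey /p13 /p23; field.
  by ring.
have e : y = k * (p12 * p13 * p23).
  have -> : y = (y ^+ 2) ^+ 2 / y ^+ 3 by field.
  by rewrite oP /p12 /p13 /p23; field.
exists ((p12 + p13 - p23) / 2), ((p12 + p23 - p13) / 2), ((p13 + p23 - p12) / 2).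
exists (x - p12 * p13 + ((p12 + p13 - p23) / 2) ^+ 2).
split; first by split; rewrite ?e1 ?e2 ?e3; field.
by rewrite /half_pt [in LHS]e; congr Affine; field.
Qed.

Lemma dbl_pt r1 r2 r3 x0 : half_param r1 r2 r3 x0 ->
  half_pt k r1 r2 r3 x0 +e half_pt k r1 r2 r3 x0 = double_pt k r1 r2 r3 x0.
Proof.
move=> h; have [[? ? ?] _] := half_param_neq h.
by rewrite -(half_param_crv h) pt_dbl.
Qed.

Lemma opp_pt r1 r2 r3 x0 :
  opp_point (half_pt k r1 r2 r3 x0) = half_pt k (- r1) (- r2) (- r3) x0.
Proof. by rewrite /half_pt /=; congr Affine; ring. Qed.

Lemma add_pt_T1 r1 r2 r3 x0 : half_param r1 r2 r3 x0 ->
  half_pt k r1 r2 r3 x0 +e Affine a1 0 = half_pt k r1 (- r2) (- r3) x0.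
Proof.
move=> h; have [[? ? ?] _] := half_param_neq h.
by rewrite -(half_param_crv h); case: h => -> _ _; rewrite crv_add_T1.
Qed.

Lemma add_pt_T2 r1 r2 r3 x0 : half_param r1 r2 r3 x0 ->
  half_pt k r1 r2 r3 x0 +e Affine a2 0 = half_pt k (- r1) r2 (- r3) x0.
Proof.
move=> h; have [[? ? ?] _] := half_param_neq h.
rewrite -(half_param_crv h); case: h => _ -> _.
by rewrite /half_cubic cubicC12 ptC12 [RHS]ptC12 crv_add_T1 // addrC.
Qed.

Lemma add_pt_T3 r1 r2 r3 x0 : half_param r1 r2 r3 x0 ->
  half_pt k r1 r2 r3 x0 +e Affine a3 0 = half_pt k (- r1) (- r2) r3 x0.
Proof.
move=> h; have [[? ? ?] _] := half_param_neq h.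
rewrite -(half_param_crv h); case: h => _ _ ->.
rewrite /half_cubic cubicC23 cubicC12 ptC23 ptC12 [RHS]ptC23 [RHS]ptC12.
by rewrite crv_add_T1 // addrC.
Qed.

(* Each sum or difference of the r_i and of the s_i is, up to a monomial, the
   product of one of u1 + u2, u1 - u2 by one of u1 u2 + D, u1 u2 - D. *)
Lemma half_pair (r1 r2 s1 s2 D u1 u2 : L) : D != 0 ->
  u1 = r1 - s1 -> u2 = r2 - s2 ->
  D = r1 ^+ 2 - s1 ^+ 2 -> D = r2 ^+ 2 - s2 ^+ 2 ->
  [/\ u1 != 0, u2 != 0,
      r1 = (D / u1 + u1) / 2, s1 = (D / u1 - u1) / 2
    & r1 + r2 = (u1 + u2) * (u1 * u2 + D) / (2 * u1 * u2)] /\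
  [/\ r1 - r2 = (u1 - u2) * (u1 * u2 - D) / (2 * u1 * u2),
      s1 + s2 = (u1 + u2) * (D - u1 * u2) / (2 * u1 * u2)
    & s1 - s2 = (u2 - u1) * (u1 * u2 + D) / (2 * u1 * u2)].
Proof.
move=> D0 e1 e2 h1 h2.
have d1 : D = (r1 + s1) * u1 by rewrite e1 h1; ring.
have d2 : D = (r2 + s2) * u2 by rewrite e2 h2; ring.
have n1 : u1 != 0 by apply: contraNneq D0 => z; rewrite d1 z mulr0.
have n2 : u2 != 0 by apply: contraNneq D0 => z; rewrite d2 z mulr0.
have f1 : r1 = (D / u1 + u1) / 2 by rewrite {1}d1 e1; field; rewrite -e1 n1 two0.
have f2 : r2 = (D / u2 + u2) / 2 by rewrite {1}d2 e2; field; rewrite -e2 n2 two0.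
have g1 : s1 = (D / u1 - u1) / 2 by rewrite {1}d1 e1; field; rewrite -e1 n1 two0.
have g2 : s2 = (D / u2 - u2) / 2 by rewrite {1}d2 e2; field; rewrite -e2 n2 two0.
by do 2!split => //; rewrite ?f1 ?f2 ?g1 ?g2; field; rewrite ?two0 ?n1 ?n2.
Qed.

Lemma half_param_sub r1 r2 r3 x0 s1 s2 s3 z0 :
  half_param r1 r2 r3 x0 -> half_param s1 s2 s3 z0 ->
  [/\ x0 - z0 = r1 ^+ 2 - s1 ^+ 2, x0 - z0 = r2 ^+ 2 - s2 ^+ 2
    & x0 - z0 = r3 ^+ 2 - s3 ^+ 2].
Proof.
case=> e1 e2 e3 [f1 f2 f3]; split.
- have -> : x0 - z0 = (x0 - r1 ^+ 2) - (z0 - s1 ^+ 2) + (r1 ^+ 2 - s1 ^+ 2) by ring.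
  by rewrite -e1 -f1 subrr add0r.
- have -> : x0 - z0 = (x0 - r2 ^+ 2) - (z0 - s2 ^+ 2) + (r2 ^+ 2 - s2 ^+ 2) by ring.
  by rewrite -e2 -f2 subrr add0r.
- have -> : x0 - z0 = (x0 - r3 ^+ 2) - (z0 - s3 ^+ 2) + (r3 ^+ 2 - s3 ^+ 2) by ring.
  by rewrite -e3 -f3 subrr add0r.
Qed.

(** Of the t_i only the pairwise sums matter later: the coordinates of a half are built from them,
    and they split into factors to which nearness applies. *)
Lemma add_half_param r1 r2 r3 x0 s1 s2 s3 z0 D u1 u2 u3 :
  half_param r1 r2 r3 x0 -> half_param s1 s2 s3 z0 ->
  D = x0 - z0 -> D != 0 -> u1 = r1 - s1 -> u2 = r2 - s2 -> u3 = r3 - s3 ->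
  exists t1 t2 t3 y0,
  [/\ half_param t1 t2 t3 y0,
      half_pt k r1 r2 r3 x0 +e half_pt k s1 s2 s3 z0 = half_pt k t1 t2 t3 y0
    & double_pt k r1 r2 r3 x0 +e double_pt k s1 s2 s3 z0 = double_pt k t1 t2 t3 y0] /\
  [/\ t1 + t2 = u3 * (D - u1 * u2) * (D + u1 * u2) / (2 * D * u1 * u2),
      t1 + t3 = u2 * (D - u1 * u3) * (D + u1 * u3) / (2 * D * u1 * u3)
    & t2 + t3 = u1 * (D - u2 * u3) * (D + u2 * u3) / (2 * D * u2 * u3)].
Proof.
move=> hr hs eD D0 e1 e2 e3.
have [d1 d2 d3] := half_param_sub hr hs; rewrite -eD in d1 d2 d3.
have [[n1 n2 f1 g1 r12] _] := half_pair D0 e1 e2 d1 d2.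
have [[_ n3 _ _ r13] _] := half_pair D0 e1 e3 d1 d3.
have [[_ _ f2 g2 r23] _] := half_pair D0 e2 e3 d2 d3.
have [[_ _ f3 g3 _] _] := half_pair D0 e3 e1 d3 d1.
have [[h12 h13 h23] _] := half_param_neq hr.
have m12 : u1 + u2 != 0 by apply: contraNneq h12 => z; rewrite r12 z !mul0r.
have m13 : u1 + u3 != 0 by apply: contraNneq h13 => z; rewrite r13 z !mul0r.
have m23 : u2 + u3 != 0 by apply: contraNneq h23 => z; rewrite r23 z !mul0r.
have ez : z0 = x0 - D by rewrite eD; ring.
clear e1 e2 e3 d1 d2 d3 r12 r13 r23 eD h12 h13 h23 hs.
have hc := half_param_crv hr.
have := pt_add k0 two0 x0 n1 n2 n3 D0 m12 m13 m23.
have := dpt_add k0 two0 x0 n1 n2 n3 D0.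
rewrite -!f1 -!f2 -!f3 -!g1 -!g2 -!g3 -ez hc => E1 E2.
do 4!eexists; split; first (split; [|exact: E2|exact: E1]).
  case: hr => h1 h2 h3; split; [rewrite h1|rewrite h2|rewrite h3];
    rewrite ?f1 ?f2 ?f3 ?g1 ?g2 ?g3; field; by rewrite ?two0 ?n1 ?n2 ?n3 ?D0.
by split; rewrite ?f1 ?f2 ?f3 ?g1 ?g2 ?g3; field; rewrite ?two0 ?n1 ?n2 ?n3 ?D0.
Qed.

Local Notation dbl P := (P +e P).

(** By [addAl] for P + T and T, and for P and T, adding T to either double gives P + (P + T); then T
    cancels. *)
Lemma dbl_add_order2 P T : on P -> on T -> opp_point T = T ->
  dbl (P +e T) = dbl P.
Proof.
move=> oP oT e; have oY := onD oP oT; have oPP := onD oP oP; have oYY := onD oY oY.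
have eT : (P +e T) +e T = P by rewrite -{2}e eaddK.
have : (P +e T) +e ((P +e T) +e T) = dbl (P +e T) +e T by rewrite eaddAl.
rewrite eT addC // eaddAl // => E.
by rewrite -[LHS](eaddK oYY oT) -E eaddK.
Qed.

Lemma order2_cases x : on (Affine x 0) -> [\/ x = a1, x = a2 | x = a3].
Proof.
rewrite /= cubicE expr0n /= => /esym/eqP; rewrite !mulf_eq0 (negPf k0) /= !subr_eq0.
by case/orP => [/orP[]|] /eqP ->; [apply: Or31|apply: Or32|apply: Or33].
Qed.

Lemma on_order2 : [/\ on (Affine a1 0), on (Affine a2 0) & on (Affine a3 0)].
Proof. by split; rewrite /= cubicE; ring. Qed.

Lemma half_signs r1 r2 r3 x0 s1 s2 s3 :
  half_param r1 r2 r3 x0 -> half_param s1 s2 s3 x0 -> r1 * r2 * r3 = s1 * s2 * s3 ->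
  [\/ [/\ s1 = r1, s2 = r2 & s3 = r3], [/\ s1 = r1, s2 = - r2 & s3 = - r3],
      [/\ s1 = - r1, s2 = r2 & s3 = - r3] | [/\ s1 = - r1, s2 = - r2 & s3 = r3]].
Proof.
move=> hr hs e; have [/esym d1 /esym d2 /esym d3] := half_param_sub hr hs.
move/eqP: d1 d2 d3; rewrite subrr subr_eq0 eq_sym eqf_sqr => d1.
move/eqP; rewrite subr_eq0 eq_sym eqf_sqr => d2.
move/eqP; rewrite subr_eq0 eq_sym eqf_sqr => d3.
have F (r : L) : - r = r -> r = 0.
  move/eqP; rewrite -subr_eq0 -opprD oppr_eq0 -mulr2n -mulr_natl mulf_eq0.
  by rewrite (negPf two0) => /eqP.
have G (r s : L) : r * s = - (r * s) -> r = 0 \/ s = 0.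
  by move=> /esym/F/eqP; rewrite mulf_eq0 => /orP[] /eqP; [left|right].
(* An odd number of sign changes forces the common product to be 0; the sign of a vanishing r_i is
   then free and restores parity. *)
have G3 : r1 * r2 * r3 = - (r1 * r2 * r3) -> [\/ r1 = 0, r2 = 0 | r3 = 0].
  case/G => [/eqP|]; last by move=> ?; apply: Or33.
  by rewrite mulf_eq0 => /orP[] /eqP ?; [apply: Or31|apply: Or32].
case/orP: d1 => /eqP d1; case/orP: d2 => /eqP d2; case/orP: d3 => /eqP d3;
  rewrite d1 d2 d3 ?(mulrN, mulNr, opprK) in e *.
- by apply: Or41.
- by case: (G3 e) => z; [apply: Or43|apply: Or42|apply: Or41]; rewrite z ?oppr0.
- by case: (G3 e) => z; [apply: Or44|apply: Or41|apply: Or42]; rewrite z ?oppr0.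
- by apply: Or42.
- by case: (G3 e) => z; [apply: Or41|apply: Or44|apply: Or43]; rewrite z ?oppr0.
- by apply: Or43.
- by apply: Or44.
- by case: (G3 e) => z; [apply: Or42|apply: Or43|apply: Or44]; rewrite z ?oppr0.
Qed.

Lemma add_order2 x1 x2 : x1 != x2 ->
  Affine x1 0 +e Affine x2 0 = Affine (a1 + a2 + a3 - x1 - x2) 0.
Proof.
move=> ne; rewrite add_chord // /chord cubic2 cubic3 subrr mul0r.
by congr Affine; field.
Qed.

Definition order2 (T : ec_point L) :=
  [\/ T = Infinity, T = Affine a1 0, T = Affine a2 0 | T = Affine a3 0].

Lemma order2_on T : order2 T -> on T.
Proof. by have [? ? ?] := on_order2; case=> ->. Qed.

Lemma order2_opp T : order2 T -> opp_point T = T.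
Proof. by case=> -> //=; rewrite oppr0. Qed.

Lemma same_double r1 r2 r3 x0 s1 s2 s3 :
  half_param r1 r2 r3 x0 -> half_param s1 s2 s3 x0 ->
  double_pt k r1 r2 r3 x0 = double_pt k s1 s2 s3 x0 ->
  exists2 T, order2 T & half_pt k s1 s2 s3 x0 = half_pt k r1 r2 r3 x0 +e T.
Proof.
move=> hr hs [/(mulfI k0) e].
case: (half_signs hr hs e) => -[-> -> ->].
- by exists Infinity; [apply: Or41|rewrite add_point0].
- by exists (Affine a1 0); [apply: Or42|rewrite add_pt_T1].
- by exists (Affine a2 0); [apply: Or43|rewrite add_pt_T2].
- by exists (Affine a3 0); [apply: Or44|rewrite add_pt_T3].
Qed.

Lemma half_param_opp r1 r2 r3 x0 :
  half_param r1 r2 r3 x0 -> half_param (- r1) (- r2) (- r3) x0.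
Proof. by case=> *; split; rewrite sqrrN. Qed.

Lemma opp_dpt r1 r2 r3 x0 :
  double_pt k (- r1) (- r2) (- r3) x0 = opp_point (double_pt k r1 r2 r3 x0).
Proof. by rewrite /double_pt /=; congr Affine; ring. Qed.

Lemma on_curve_cases P : on P -> order2 P \/
  exists r1 r2 r3 x0, half_param r1 r2 r3 x0 /\ P = half_pt k r1 r2 r3 x0.
Proof.
case: P => [|x y] oP; first by left; apply: Or41.
have [y0|y0] := eqVneq y 0; last by right; apply: on_pt_exists.
left; rewrite y0 in oP *.
by case: (order2_cases oP) => ->; [apply: Or42|apply: Or43|apply: Or44].
Qed.

(** The last case is the generic one, where the doubles have distinct abscissas and the
    parametrisation by the u_i and D applies. Equal abscissas mean that the doubles agree up to
    sign, so Q is P or -P up to 2-torsion. *)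
Lemma dbl_add_cases P Q : on P -> on Q ->
  [\/ order2 P \/ order2 Q, exists2 T, order2 T & Q = P +e T,
      exists2 T, order2 T & Q = opp_point P +e T
    | exists r1 r2 r3 x0 s1 s2 s3 z0,
      [/\ half_param r1 r2 r3 x0, half_param s1 s2 s3 z0, x0 != z0,
          P = half_pt k r1 r2 r3 x0 & Q = half_pt k s1 s2 s3 z0]].
Proof.
move=> oP oQ.
have [t|[r1 [r2 [r3 [x0 [hr er]]]]]] := on_curve_cases oP; first by apply: Or41; left.
have [t|[s1 [s2 [s3 [z0 [hs es]]]]]] := on_curve_cases oQ; first by apply: Or41; right.
have [e|ne] := eqVneq x0 z0; last first.
  by apply: Or44; exists r1, r2, r3, x0, s1, s2, s3, z0.
rewrite -{}e in hs es; have oP' := onD oP oP; have oQ' := onD oQ oQ.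
rewrite er dbl_pt // in oP'; rewrite es dbl_pt // in oQ'.
rewrite er es; have [e|e] := on_same_x oP' oQ'.
  by apply: Or42; apply: same_double => //; rewrite /double_pt e.
apply: Or43; rewrite opp_pt; apply: same_double => //; first exact: half_param_opp.
by rewrite opp_dpt /double_pt /= e opprK.
Qed.

(** In the generic case the sum of the halves and the sum of the doubles are [half_pt] and
    [double_pt] of the same parameters t_i. *)
Lemma dbl_add P Q : on P -> on Q -> dbl (P +e Q) = dbl P +e dbl Q.
Proof.
move=> oP oQ; have D2 T : order2 T -> dbl T = Infinity.
  by move=> t; rewrite -{2}(order2_opp t) add_opp.
have [[t|t]|[T t e]|[T t e]|] := dbl_add_cases oP oQ.
- by rewrite (D2 _ t) addC // dbl_add_order2 // order2_opp.
- by rewrite (D2 _ t) dbl_add_order2 ?order2_opp // add_point0.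
- have oT := order2_on t; have eT := order2_opp t; have oPP := onD oP oP.
  rewrite {}e in oQ *; rewrite eaddAl // dbl_add_order2 //.
  by rewrite (dbl_add_order2 oP oT eT).
- have oT := order2_on t; have eT := order2_opp t; have oN := on_opp oP.
  have eS : P +e (opp_point P +e T) = T.
    rewrite addC //; last exact: onD.
    by rewrite (addC oN oT) -{2}[P]opp_pointK eaddK.
  by rewrite e eS (D2 _ t) (dbl_add_order2 oN oT eT) oppD // add_opp.
- case=> r1 [r2 [r3 [x0 [s1 [s2 [s3 [z0 [hr hs ne -> ->]]]]]]]].
  have D0 : x0 - z0 != 0 by rewrite subr_eq0.
  have [t1 [t2 [t3 [y0 [[ht -> E] _]]]]] :=
    add_half_param hr hs erefl D0 erefl erefl erefl.
  by rewrite !dbl_pt.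
Qed.

End Halving.

(** * Multiples by powers of 2 and chains of halves *)

Section Multiples.
Variables (L : fieldType) (k a1 a2 a3 : L).
Hypotheses (k0 : k != 0) (two0 : (2 : L) != 0).
Hypotheses (a12 : a1 != a2) (a13 : a1 != a3) (a23 : a2 != a3).
Local Notation g := (cubic k a1 a2 a3).
Local Notation "P +e Q" := (add_point g P Q) (at level 50, left associativity).
Local Notation on := (on_curve g).
Local Notation dbl P := (P +e P).
Let sg := size_cubic a1 a2 a3 k0.
Let smooth := cubic_smooth k0 a12 a13 a23.
Let onD := on_add two0 sg.
Let dblD := dbl_add k0 two0 a12 a13 a23.

Lemma mul_pointS n P : mul_point g n.+1 P = P +e mul_point g n P.
Proof. by []. Qed.

Lemma mul_point_on n P : on P -> on (mul_point g n P).
Proof. by move=> oP; elim: n => //= n IH; apply: onD. Qed.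

Lemma mul_point2 P : mul_point g 2 P = dbl P.
Proof. by rewrite !mul_pointS add_point0. Qed.

Lemma mul_pointD m n P : mul_point g (m + n) P =
  iter m (add_point g P) (mul_point g n P).
Proof. by rewrite /mul_point iterD. Qed.

Lemma dbl_mul n P : on P -> dbl (mul_point g n P) = mul_point g n (dbl P).
Proof.
move=> oP; elim: n => // n IH; rewrite !mul_pointS dblD ?IH //.
exact: mul_point_on.
Qed.

Lemma mul_point_double n P : on P -> mul_point g n.*2 P = mul_point g n (dbl P).
Proof.
move=> oP; elim: n => // n IH.
by rewrite doubleS !mul_pointS IH (addAl two0 sg smooth) //; apply/mul_point_on/onD.
Qed.

Lemma mul_point_pow2 n P : on P ->
  mul_point g (2 ^ n) P = iter n (fun Q => dbl Q) P.
Proof.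
move=> oP; elim: n P oP => [|n IH] P oP; first by rewrite /= add_point0.
by rewrite expnS mul2n mul_point_double // IH ?iterSr //; apply: onD.
Qed.

(** A chain of halves that starts at [Infinity] is torsion of the right order at every level, so
    only doublings remain to be controlled. *)
Lemma tate2P (P : nat -> ec_point L) : tate2 g P <->
  P 0 = Infinity /\ forall n, on (P n) /\ dbl (P n.+1) = P n.
Proof.
split=> [h|[h0 h]].
  have onP n : on (P n) by have [[]] := h n.
  split=> [|n]; last by split=> //; have [_] := h n; rewrite mul_point2.
  by have [[_]] := h 0; rewrite /= add_point0.
have onP n : on (P n) by have [] := h n.
move=> n; split; last by rewrite mul_point2; have [] := h n.
split=> //; rewrite mul_point_pow2 //; elim: n => // n IH.
by rewrite iterSr; have [_ ->] := h n.
Qed.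

Lemma tate_add_closed P Q : tate2 g P -> tate2 g Q -> tate2 g (tate_add g P Q).
Proof.
move=> /tate2P [P0 hP] /tate2P [Q0 hQ]; apply/tate2P; rewrite /tate_add.
split=> [|n]; first by rewrite P0 Q0.
have [oP eP] := hP n; have [oQ eQ] := hQ n.
have [oP' _] := hP n.+1; have [oQ' _] := hQ n.+1.
by split; [exact: onD | rewrite dblD // eP eQ].
Qed.

(** Consecutive residues of a 2-adic integer agree only modulo 2^n, which must suffice to fix the
    multiple of a 2^n-torsion point. *)
Lemma mul_point_mod m n j P : on P -> mul_point g (2 ^ n) P = Infinity ->
  m = j %[mod 2 ^ n] -> mul_point g m P = mul_point g j P.
Proof.
move=> oP e; suff F i : mul_point g i P = mul_point g (i %% 2 ^ n)%N P.
  by move=> h; rewrite F h -F.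
rewrite {1}(divn_eq i (2 ^ n)); move: (i %/ _)%N (i %% _)%N => q r.
elim: q => // q IH.
by rewrite mulSn -addnA addnC mul_pointD e.
Qed.

Lemma tate_scale_closed z P : tate2 g P -> tate2 g (tate_scale g z P).
Proof.
move=> tP; have /tate2P [P0 hP] := tP; apply/tate2P; rewrite /tate_scale.
split=> [|n].
  rewrite P0; elim: (nat_of_ord _) => // m IH.
have [oP eP] := hP n; have [oP' _] := hP n.+1.
split; first exact: mul_point_on.
rewrite dbl_mul // eP; apply: (@mul_point_mod _ n) => //; last exact: residue_compat.
by have [[]] := tP n.
Qed.

End Multiples.

(** * Valuations and principal units *)

Section Valuation.
Variables (F : fieldType) (R : realDomainType) (v : F -> \bar R).
Hypothesis vv : valuation v.

Lemma val_fine x : x != 0 -> v x = (fine (v x))%:E.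
Proof. by move=> /(Defs.val_fin vv) h; rewrite fineK. Qed.

Lemma valuation1 : v 1 = 0%E.
Proof.
have := Defs.valM vv 1 1; rewrite mulr1 (val_fine (oner_neq0 F)) -EFinD => -[] /eqP.
by rewrite -subr_eq0 opprD addrA subrr sub0r oppr_eq0 => /eqP ->.
Qed.

Lemma valuationN1 : v (-1) = 0%E.
Proof.
have n1 : (-1 : F) != 0 by rewrite oppr_eq0 oner_neq0.
have := Defs.valM vv (-1) (-1); rewrite mulrNN mulr1 valuation1 (val_fine n1) -EFinD => -[] /eqP.
by rewrite eq_sym -mulr2n mulrn_eq0 /= => /eqP ->.
Qed.

Lemma valuationN x : v (- x) = v x.
Proof. by rewrite -mulN1r (Defs.valM vv) valuationN1 add0e. Qed.

Lemma valuationV x : x != 0 -> v x^-1 = (- v x)%E.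
Proof.
move=> x0; have xV0 : x^-1 != 0 by rewrite invr_eq0.
have := Defs.valM vv x x^-1; rewrite mulfV // valuation1 (val_fine x0) (val_fine xV0) -EFinD -EFinN.
by case=> /eqP; rewrite eq_sym addrC addr_eq0 => /eqP ->.
Qed.

Lemma valB_ge B x y : (B <= v x -> B <= v y -> B <= v (x - y)%R)%E.
Proof. by move=> h1 h2; apply: le_trans (Defs.valD vv _ _); rewrite valuationN le_min h1. Qed.

Lemma valD_ge B x y : (B <= v x -> B <= v y -> B <= v (x + y)%R)%E.
Proof. by move=> h1 h2; apply: le_trans (Defs.valD vv _ _); rewrite le_min h1. Qed.

Lemma valD_gt B x y : (B < v x -> B < v y -> B < v (x + y)%R)%E.
Proof. by move=> h1 h2; apply: lt_le_trans (Defs.valD vv _ _); rewrite lt_min h1. Qed.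

Lemma valB_gt B x y : (B < v x -> B < v y -> B < v (x - y)%R)%E.
Proof. by move=> h1 h2; apply: valD_gt; rewrite ?valuationN. Qed.

Lemma val_sum_ge B (I : Type) (r : seq I) (P : pred I) (f : I -> F) :
  (forall i, P i -> (B <= v (f i))%E) -> (B <= v (\sum_(i <- r | P i) f i)%R)%E.
Proof.
move=> h; elim/big_ind: _ => //; first by rewrite (Defs.val0 vv) leey.
by move=> x y; apply: valD_ge.
Qed.

Lemma val_eq0 x : (forall B : R, (B%:E <= v x)%E) -> x = 0.
Proof.
move=> h; apply/eqP/negPn/negP => x0; have := h (fine (v x) + 1).
by rewrite {2}(val_fine x0) lee_fin gerDl ler10.
Qed.

Lemma valM_gt0 x y : (0 < v x -> 0 <= v y -> 0 < v (x * y)%R)%E.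
Proof. by move=> h1 h2; rewrite (Defs.valM vv) (lt_le_trans h1) ?leeDl. Qed.

Lemma valM_ge0 x y : (0 <= v x -> 0 <= v y -> 0 <= v (x * y)%R)%E.
Proof. by move=> h1 h2; rewrite (Defs.valM vv) adde_ge0. Qed.

Lemma val_nat_ge0 n : (0 <= v n%:R)%E.
Proof.
elim: n => [|n IH]; first by rewrite (Defs.val0 vv) leey.
by rewrite -addn1 natrD; apply: valD_ge; rewrite // valuation1.
Qed.

(* [u] is a principal unit; [near x y] also holds for x = y = 0. *)
Definition near x y := exists2 u, (0 < v (u - 1))%E & x = u * y.

Lemma unit_val u : (0 < v (u - 1))%E -> v u = 0%E.
Proof.
move=> h; apply/eqP; rewrite eq_le; apply/andP; split; last first.
  by rewrite -[u](subrK 1); apply: valD_ge; rewrite ?valuation1 // ltW.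
rewrite leNgt; apply/negP => h'; have := valB_gt h' h.
by rewrite subKr valuation1 ltxx.
Qed.

Lemma unit_neq0 u : (0 < v (u - 1))%E -> u != 0.
Proof. by apply: contraTneq => ->; rewrite sub0r valuationN valuation1 ltxx. Qed.

Lemma near_refl x : near x x.
Proof. by exists 1; rewrite ?mul1r // subrr (Defs.val0 vv) ltry. Qed.
#[local] Hint Resolve near_refl : core.

Lemma near_sym x y : near x y -> near y x.
Proof.
case=> u h ->; have u0 := unit_neq0 h; exists u^-1; last by rewrite mulKf.
have -> : u^-1 - 1 = (u - 1) * (- u^-1) by field.
by apply: valM_gt0; rewrite // valuationN valuationV // unit_val // oppe0.
Qed.

Lemma near_mul x x' y y' : near x x' -> near y y' -> near (x * y) (x' * y').
Proof.
case=> u h -> [t h' ->]; exists (u * t); last by rewrite mulrACA.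
have -> : u * t - 1 = (u - 1) * t + (t - 1) by ring.
by apply: valD_gt => //; apply: valM_gt0; rewrite // unit_val.
Qed.

Lemma near_inv x y : near x y -> near x^-1 y^-1.
Proof.
move=> h; have [u hu ->] := near_sym h; rewrite invfM; exists u => //.
have u0 := unit_neq0 hu; by rewrite mulVKf.
Qed.

Lemma near_div x x' y y' : near x x' -> near y y' -> near (x / y) (x' / y').
Proof. by move=> h h'; apply: near_mul => //; apply: near_inv. Qed.

Lemma near_opp x y : near x y -> near (- x) (- y).
Proof. by case=> u h ->; exists u; rewrite ?mulrN. Qed.

Lemma near0 x y : near x y -> (x == 0) = (y == 0).
Proof. by case=> u /unit_neq0 h ->; rewrite mulf_eq0 (negPf h). Qed.

Lemma near_mulI z z' x x' : z != 0 -> near z z' -> near (z * x) (z' * x') -> near x x'.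
Proof.
move=> z0 h h'; have z0' : z' != 0 by rewrite -(near0 h).
by rewrite -(mulKf z0 x) -(mulKf z0' x'); apply: near_mul => //; apply: near_inv.
Qed.

Lemma near_close x y : y != 0 -> (v y < v (x - y)%R)%E -> near x y.
Proof.
move=> y0 h; exists (x / y); last by rewrite divfK.
have -> : x / y - 1 = (x - y) / y by field.
by rewrite (Defs.valM vv) valuationV // sube_gt0.
Qed.

Hypothesis v2 : ~~ (0 < v 2)%E.

Lemma two_neq0 : (2 : F) != 0.
Proof. by apply: contraNneq v2 => ->; rewrite (Defs.val0 vv) ltry. Qed.

(** Two principal units cannot add up to 0, since 2 would then have positive valuation. This is how
    nearness selects between two square roots. *)
Lemma near_oppN x y : near x y -> near x (- y) -> y = 0.
Proof.
case=> u h -> [t h' /eqP]; rewrite mulrN -mulNr -subr_eq0 -mulrBl mulf_eq0.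
case/orP => [|/eqP //]; rewrite opprK => /eqP e; case/negP: v2.
have -> : 2 = - ((u - 1) + (t - 1)).
  have -> : u - 1 + (t - 1) = u + t - 2 by ring.
  by rewrite e sub0r opprK.
by rewrite valuationN; apply: valD_gt.
Qed.

(* As 2 is a unit, x + y and x - y cannot both have smaller absolute value than
   x and y. *)
Lemma near_addB x x' y y' : near x x' -> near y y' ->
  near (x + y) (x' + y') \/ near (x - y) (x' - y').
Proof.
suff W p q p' q' : (v p' <= v q')%E -> near p p' -> near q q' ->
    near (p + q) (p' + q') \/ near (p - q) (p' - q').
  move=> h h'; have [le|/ltW le] := leP (v x') (v y'); first exact: W.
  have [|] := W _ _ _ _ le h' h; first by rewrite addrC (addrC y'); left.
  by move=> /near_opp; rewrite !opprB; right.
move=> le [u hu ->] [t ht ->].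
have [->|p0] := eqVneq p' 0; first by rewrite mulr0 !add0r; left; exists t.
pose c := q' / p'.
have c_int : (0 <= v c)%E.
  by rewrite (Defs.valM vv) valuationV // sube_ge0 // (Defs.val_fin vv p0).
have eq : q' = c * p' by rewrite divfK.
have [h|h] : ~~ (0 < v (1 + c)%R)%E \/ ~~ (0 < v (1 - c)%R)%E.
  apply/orP; rewrite -negb_and; apply: contra v2 => /andP[h1 h2].
  have -> : 2 = (1 + c) + (1 - c) by ring.
  exact: valD_gt.
- left; rewrite eq; have n0 : 1 + c != 0.
    by apply: contraNneq h => ->; rewrite (Defs.val0 vv) ltry.
  exists (1 + ((u - 1) + (t - 1) * c) / (1 + c)); last by field.
  rewrite addrC addKr; apply: valM_gt0.
    by apply: valD_gt => //; apply: valM_gt0.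
  by rewrite valuationV // oppe_ge0 leNgt.
- right; rewrite eq; have n0 : 1 - c != 0.
    by apply: contraNneq h => ->; rewrite (Defs.val0 vv) ltry.
  exists (1 + ((u - 1) - (t - 1) * c) / (1 - c)); last by field.
  rewrite addrC addKr; apply: valM_gt0.
    by apply: valB_gt => //; apply: valM_gt0.
  by rewrite valuationV // oppe_ge0 leNgt.
Qed.

Lemma near_addB_mul x x' y y' : near x x' -> near y y' ->
  near ((x + y) * (x - y)) ((x' + y') * (x' - y')) ->
  (x + y) * (x - y) != 0 ->
  near (x + y) (x' + y') /\ near (x - y) (x' - y').
Proof.
move=> h h' hp; rewrite mulf_eq0 negb_or => /andP[n1 n2].
have [d|d] := near_addB h h'; split => //; first exact: near_mulI hp.
by apply: near_mulI n2 d _; rewrite mulrC [_ * (x' + _)]mulrC.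
Qed.

End Valuation.

Section SquareRoots.
Variables (L : closedFieldType) (R : realDomainType) (v : L -> \bar R).
Hypothesis vv : valuation v.

Lemma closed_sqrt (x : L) : exists y, y ^+ 2 = x.
Proof.
have := @solve_monicpoly L 2 (fun i => if i == 0%N then x else 0) isT.
case=> y; rewrite big_ord_recl big_ord1 /= mulr1 mul0r addr0 => <-.
by exists y.
Qed.

(** If t^2 = u is a principal unit, then (t - 1)(t + 1) = u - 1 has positive valuation, so t or -t
    is principal. *)
Lemma near_sqrt x y : near v x (y ^+ 2) -> exists2 z, z ^+ 2 = x & near v z y.
Proof.
case=> u hu ->; have [t et] := closed_sqrt u.
have hp : (0 < v ((t - 1) * (t + 1))%R)%E by rewrite -subr_sqr et expr1n.
have : (0 < v (t - 1)%R)%E \/ (0 < v (t + 1)%R)%E.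
  apply/orP; move: hp; apply: contraTT.
  by rewrite negb_or -!leNgt => /andP[h1 h2]; rewrite (Defs.valM vv) adde_le0.
case=> h; first by exists (t * y); rewrite ?exprMn ?et //; exists t.
exists (- t * y); first by rewrite exprMn sqrrN et.
by exists (- t) => //; rewrite -opprD valuationN.
Qed.
End SquareRoots.

(** * Corresponding torsion points *)

Section NearHalves.
Variables (L : closedFieldType) (R : realDomainType) (w : L -> \bar R).
Hypotheses (vw : valuation w) (w2 : ~~ (0 < w 2)%E).
Local Notation "x =~ y" := (near w x y) (at level 70).
Let two0 := two_neq0 vw w2.
Let refl := near_refl vw.

(* Non-cancellation forbids r_i ~ - s_i for two indices i, the product for
   exactly one. *)
Lemma near_halves (a1 a2 a3 b1 b2 b3 r1 r2 r3 x0 s1 s2 s3 z0 : L) :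
  a1 != a2 -> a1 != a3 -> a2 != a3 ->
  a1 - a2 =~ b1 - b2 -> a1 - a3 =~ b1 - b3 -> a2 - a3 =~ b2 - b3 ->
  half_param a1 a2 a3 r1 r2 r3 x0 -> half_param b1 b2 b3 s1 s2 s3 z0 ->
  r1 + r2 =~ s1 + s2 -> r1 + r3 =~ s1 + s3 -> r2 + r3 =~ s2 + s3 ->
  r1 ^+ 2 =~ s1 ^+ 2 -> r2 ^+ 2 =~ s2 ^+ 2 -> r3 ^+ 2 =~ s3 ^+ 2 ->
  r1 * r2 * r3 =~ s1 * s2 * s3 ->
  [/\ r1 =~ s1, r2 =~ s2 & r3 =~ s3].
Proof.
move=> n12 n13 n23 h12 h13 h23 hr hs p12 p13 p23 q1 q2 q3 pr.
have [[m12 m13 m23] [d12 d13 d23]] := half_param_neq n12 n13 n23 hr.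
have sub (a b r s c d t u x z : L) : a - b =~ c - d -> a = x - r ^+ 2 ->
    b = x - s ^+ 2 -> c = z - t ^+ 2 -> d = z - u ^+ 2 -> r + s != 0 ->
    r + s =~ t + u -> r - s =~ t - u.
  move=> h ea eb ec ed n hp; apply: near_mulI n hp _ => //.
  have -> : (r + s) * (r - s) = - (x - r ^+ 2 - (x - s ^+ 2)) by ring.
  have -> : (t + u) * (t - u) = - (z - t ^+ 2 - (z - u ^+ 2)) by ring.
  by rewrite -ea -eb -ec -ed; apply: near_opp.
have sq (r s : L) : r ^+ 2 =~ s ^+ 2 -> r =~ s \/ r =~ - s.
  move/(near_sym vw)/(near_sqrt vw) => [z /eqP]; rewrite eqf_sqr => /orP[] /eqP ->.
    by move=> /(near_sym vw) h; left.
  by move=> /(near_sym vw) h; right.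
have nb (r s t u : L) : r + s != 0 -> r - s != 0 -> r + s =~ t + u -> r - s =~ t - u ->
    r =~ - t -> s =~ - u -> False.
  move=> n1 n2 h1 h2 hr' hs'; have [d|d] := near_addB vw w2 hr' hs'.
    by move: n1; rewrite (near0 vw h1) (near_oppN vw w2 h1) ?eqxx // opprD.
  by move: n2; rewrite (near0 vw h2) (near_oppN vw w2 h2) ?eqxx // opprD.
case: (hr) (hs) => [ea1 ea2 ea3] [eb1 eb2 eb3].
have g12 := sub _ _ _ _ _ _ _ _ _ _ h12 ea1 ea2 eb1 eb2 m12 p12.
have g13 := sub _ _ _ _ _ _ _ _ _ _ h13 ea1 ea3 eb1 eb3 m13 p13.
have g23 := sub _ _ _ _ _ _ _ _ _ _ h23 ea2 ea3 eb2 eb3 m23 p23.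
have nb12 := nb _ _ _ _ m12 d12 p12 g12.
have nb13 := nb _ _ _ _ m13 d13 p13 g13.
have nb23 := nb _ _ _ _ m23 d23 p23 g23.
case: (sq _ _ q1) => c1; case: (sq _ _ q2) => c2; case: (sq _ _ q3) => c3;
  try (by split); try (by case: (nb12 c1 c2)); try (by case: (nb13 c1 c3));
  try (by case: (nb23 c2 c3)).
(* Exactly one sign is reversed here, so the product is near its own opposite and some s_i is 0.
   Either i is the reversed index and the reversal is void, or r_i is also near -s_i, and two
   reversals are excluded. *)
- have e : r1 * r2 * r3 =~ - (s1 * s2 * s3).
    by rewrite -mulrN; apply: near_mul => //; apply: near_mul.
  have := near_oppN vw w2 pr e => /eqP; rewrite !mulf_eq0 => /orP[/orP[]|] /eqP z.
  + by case: (nb13 _ c3); rewrite z oppr0; rewrite z in c1.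
  + by case: (nb23 _ c3); rewrite z oppr0; rewrite z in c2.
  + by rewrite z oppr0 in c3 *.
- have e : r1 * r2 * r3 =~ - (s1 * s2 * s3).
    by rewrite -mulNr -mulrN; apply: near_mul => //; apply: near_mul.
  have := near_oppN vw w2 pr e => /eqP; rewrite !mulf_eq0 => /orP[/orP[]|] /eqP z.
  + by case: (nb12 _ c2); rewrite z oppr0; rewrite z in c1.
  + by rewrite z oppr0 in c2 *.
  + by case: (nb23 c2 _); rewrite z oppr0; rewrite z in c3.
- have e : r1 * r2 * r3 =~ - (s1 * s2 * s3).
    by rewrite -!mulNr; apply: near_mul => //; apply: near_mul.
  have := near_oppN vw w2 pr e => /eqP; rewrite !mulf_eq0 => /orP[/orP[]|] /eqP z.
  + by rewrite z oppr0 in c1 *.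
  + by case: (nb12 c1 _); rewrite z oppr0; rewrite z in c2.
  + by case: (nb13 c1 _); rewrite z oppr0; rewrite z in c3.
Qed.
End NearHalves.

(** * Nearness of the parameters of two points *)

Section NearPairs.
Variables (L : closedFieldType) (R : realDomainType) (w : L -> \bar R).
Hypotheses (vw : valuation w) (w2 : ~~ (0 < w 2)%E).
Local Notation "x =~ y" := (near w x y) (at level 70).
Let two0 := two_neq0 vw w2.
Let refl := near_refl vw.

Lemma near_sub_halves (D D' r r' s s' : L) : D != 0 -> D =~ D' ->
  r =~ r' -> s =~ s' -> D = r ^+ 2 - s ^+ 2 -> D' = r' ^+ 2 - s' ^+ 2 ->
  r - s =~ r' - s'.
Proof.
move=> D0 hD hr hs e e'; apply: (near_addB_mul vw w2 hr hs _ _).2.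
  by rewrite [_ * _]mulrC -subr_sqr -e [_ * _]mulrC -subr_sqr -e'.
by rewrite mulrC -subr_sqr -e.
Qed.

(** By the factorisations of [half_pair], three products of one of u1 + u2, u1 - u2 with one of D +
    u1 u2, D - u1 u2 are near their counterparts, up to sign. [near_addB] gives a first factor, and
    successive cancellation separates the others. *)
Lemma near_half_pair (D D' r1 r2 s1 s2 r1' r2' s1' s2' : L) : D != 0 -> D =~ D' ->
  r1 =~ r1' -> r2 =~ r2' -> s1 =~ s1' -> s2 =~ s2' ->
  r1 + r2 =~ r1' + r2' -> r1 - r2 =~ r1' - r2' -> s1 + s2 =~ s1' + s2' ->
  r1 + r2 != 0 -> r1 - r2 != 0 -> s1 + s2 != 0 ->
  D = r1 ^+ 2 - s1 ^+ 2 -> D = r2 ^+ 2 - s2 ^+ 2 ->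
  D' = r1' ^+ 2 - s1' ^+ 2 -> D' = r2' ^+ 2 - s2' ^+ 2 ->
  forall u1 u2 u1' u2', u1 = r1 - s1 -> u2 = r2 - s2 ->
  u1' = r1' - s1' -> u2' = r2' - s2' ->
  [/\ u1 + u2 =~ u1' + u2', D + u1 * u2 =~ D' + u1' * u2'
    & D - u1 * u2 =~ D' - u1' * u2'].
Proof.
move=> D0 hD hr1 hr2 hs1 hs2 hp hm hq n1 n2 n3 d1 d2 d1' d2' u1 u2 u1' u2' e1 e2 e1' e2'.
have D0' : D' != 0 by rewrite -(near0 vw hD).
have hu1 : u1 =~ u1' by rewrite e1 e1'; apply: near_sub_halves hD hr1 hs1 d1 d1'.
have hu2 : u2 =~ u2' by rewrite e2 e2'; apply: near_sub_halves hD hr2 hs2 d2 d2'.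
have [[u10 u20 _ _ r12] [m12 s12 _]] := half_pair two0 D0 e1 e2 d1 d2.
have [[u10' u20' _ _ r12'] [m12' s12' _]] := half_pair two0 D0' e1' e2' d1' d2'.
have huu : 2 * u1 * u2 =~ 2 * u1' * u2' by do 2!apply: near_mul => //.
have clear_denom (x a b y a' b' u u' : L) : x =~ y -> u =~ u' -> u != 0 ->
    x = a * b / u -> y = a' * b' / u' -> a * b =~ a' * b'.
  move=> h hu u0 e e'; rewrite {}e {}e' in h; have u0' : u' != 0 by rewrite -(near0 vw hu).
  by rewrite -[a * b](divfK u0) -[a' * b'](divfK u0'); apply: near_mul.
have uu0 : 2 * u1 * u2 != 0 by rewrite !mulf_neq0.
have P := clear_denom _ _ _ _ _ _ _ _ hp huu uu0 r12 r12'.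
have Q := clear_denom _ _ _ _ _ _ _ _ hm huu uu0 m12 m12'.
have S := clear_denom _ _ _ _ _ _ _ _ hq huu uu0 s12 s12'.
have a0 : u1 + u2 != 0 by apply: contraNneq n1 => z; rewrite r12 z !mul0r.
have b0 : u1 - u2 != 0 by apply: contraNneq n2 => z; rewrite m12 z !mul0r.
have c0 : D - u1 * u2 != 0 by apply: contraNneq n3 => z; rewrite s12 z mulr0 mul0r.
have key : u1 + u2 =~ u1' + u2'.
  have [//|h] := near_addB vw w2 hu1 hu2.
  have := near_opp (near_mulI vw b0 h Q); rewrite !opprB => h'.
  by apply: near_mulI c0 h' _; rewrite // mulrC [_ * (u1' + _)]mulrC.
by split; rewrite // ?[_ + _ * _]addrC; apply: near_mulI a0 key _.
Qed.
End NearPairs.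

Section Correspondence.
Variables (L : closedFieldType) (R : realDomainType) (w : L -> \bar R).
Hypotheses (vw : valuation w) (w2 : ~~ (0 < w 2)%E).
Local Notation "x =~ y" := (near w x y) (at level 70).

Section Definitions.
Variables (k k' a1 a2 a3 b1 b2 b3 : L).

(** On a half, the functions x - a_i and y / k are products of the sums r_i + r_j, which is the form
    that nearness can follow. *)
Definition near_point (P P' : ec_point L) : Prop :=
  match P, P' with
  | Infinity, Infinity => True
  | Affine x y, Affine x' y' =>
      [/\ x - a1 =~ x' - b1, x - a2 =~ x' - b2, x - a3 =~ x' - b3
        & y / k =~ y' / k']
  | _, _ => False
  end.

(* The 2^n-torsion points of the two curves are matched along n doublings. *)
Fixpoint corresp n (P P' : ec_point L) : Prop :=
  if n is m.+1 then
    [/\ on_curve (cubic k a1 a2 a3) P, on_curve (cubic k' b1 b2 b3) P',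
        near_point P P'
      & corresp m (add_point (cubic k a1 a2 a3) P P)
                  (add_point (cubic k' b1 b2 b3) P' P')]
  else P = Infinity /\ P' = Infinity.

Definition order2_pair (T T' : ec_point L) : Prop :=
  [\/ T = Infinity /\ T' = Infinity, T = Affine a1 0 /\ T' = Affine b1 0,
      T = Affine a2 0 /\ T' = Affine b2 0 | T = Affine a3 0 /\ T' = Affine b3 0].
End Definitions.

Lemma corresp_sym k k' a1 a2 a3 b1 b2 b3 n P P' :
  corresp k k' a1 a2 a3 b1 b2 b3 n P P' -> corresp k' k b1 b2 b3 a1 a2 a3 n P' P.
Proof.
elim: n P P' => [|n IH] P P' /=; first by case.
case=> oP oP' h /IH h'; split=> //.
by case: P P' h {oP oP' h'} => [|x y] [|x' y'] //= [*]; split; apply: near_sym.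
Qed.

Variables (k k' a1 a2 a3 b1 b2 b3 : L).
Hypotheses (k0 : k != 0) (k0' : k' != 0).
Hypotheses (a12 : a1 != a2) (a13 : a1 != a3) (a23 : a2 != a3).
Hypotheses (n12 : a1 - a2 =~ b1 - b2) (n13 : a1 - a3 =~ b1 - b3)
  (n23 : a2 - a3 =~ b2 - b3).
Let two0 := two_neq0 vw w2.
Let refl := near_refl vw.

Let b12 : b1 != b2. Proof. by rewrite -subr_eq0 -(near0 vw n12) subr_eq0. Qed.
Let b13 : b1 != b3. Proof. by rewrite -subr_eq0 -(near0 vw n13) subr_eq0. Qed.
Let b23 : b2 != b3. Proof. by rewrite -subr_eq0 -(near0 vw n23) subr_eq0. Qed.
Let n21 : a2 - a1 =~ b2 - b1. Proof. by have := near_opp n12; rewrite !opprB. Qed.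
Let n31 : a3 - a1 =~ b3 - b1. Proof. by have := near_opp n13; rewrite !opprB. Qed.
Let n32 : a3 - a2 =~ b3 - b2. Proof. by have := near_opp n23; rewrite !opprB. Qed.
Let n0 : (0 : L) =~ 0. Proof. exact: refl. Qed.

Local Notation g := (cubic k a1 a2 a3).
Local Notation g' := (cubic k' b1 b2 b3).
Local Notation "P +e Q" := (add_point g P Q) (at level 50, left associativity).
Local Notation "P +f Q" := (add_point g' P Q) (at level 50, left associativity).
Local Notation nearP := (near_point k k' a1 a2 a3 b1 b2 b3).
Local Notation M := (corresp k k' a1 a2 a3 b1 b2 b3).
Local Notation hpa := (half_param a1 a2 a3).
Local Notation hpb := (half_param b1 b2 b3).
Local Notation T2 := (order2_pair a1 a2 a3 b1 b2 b3).

Let sg := size_cubic a1 a2 a3 k0.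
Let sg' := size_cubic b1 b2 b3 k0'.
Let onD := on_add two0 sg.
Let onD' := on_add two0 sg'.

Lemma corresp_Infinity n : M n Infinity Infinity.
Proof. by elim: n => //= n IH; split. Qed.

Lemma corresp_on n P P' : M n P P' -> on_curve g P /\ on_curve g' P'.
Proof. by case: n => [[-> ->]|n []]. Qed.

Lemma corresp_near n P P' : M n P P' -> nearP P P'.
Proof. by case: n => [[-> ->]|n []]. Qed.

Lemma order2_pair_l T T' : T2 T T' -> order2 a1 a2 a3 T.
Proof. by case=> -[-> _]; [apply: Or41|apply: Or42|apply: Or43|apply: Or44]. Qed.

Lemma order2_pair_r T T' : T2 T T' -> order2 b1 b2 b3 T'.
Proof. by case=> -[_ ->]; [apply: Or41|apply: Or42|apply: Or43|apply: Or44]. Qed.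

Lemma order2_pair_exists T : order2 a1 a2 a3 T -> exists T', T2 T T'.
Proof.
case=> ->; eexists;
  by [apply: Or41|apply: Or42|apply: Or43|apply: Or44].
Qed.

Lemma order2_pair_near T T' : T2 T T' -> nearP T T'.
Proof. by case=> -[-> ->] //=; rewrite !mul0r ?subrr; split. Qed.

Lemma order2_pair_corresp n T T' : T2 T T' -> M n.+1 T T'.
Proof.
move=> t; split.
- exact: order2_on (order2_pair_l t).
- exact: order2_on (order2_pair_r t).
- exact: order2_pair_near.
rewrite -{2}(order2_opp (order2_pair_l t)) -{2}(order2_opp (order2_pair_r t)).
by rewrite !add_opp; apply: corresp_Infinity.
Qed.

(** Only 0 is near 0, so the vanishing of y and of x - a_i is transported exactly. *)
Lemma near_order2_pair T P' : order2 a1 a2 a3 T -> on_curve g' P' ->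
  nearP T P' -> T2 T P'.
Proof.
have y0 (y : L) : 0 / k =~ y / k' -> y = 0.
  by move/(near0 vw)/esym; rewrite mul0r eqxx mulf_eq0 invr_eq0 (negPf k0') orbF => /eqP.
have x0 (x b : L) : 0 =~ x - b -> x = b.
  by move/(near0 vw)/esym; rewrite eqxx subr_eq0 => /eqP.
case=> ->; case: P' => [|x y] //= _; first by move=> _; apply: Or41.
- by rewrite subrr => -[/x0 -> _ _ /y0 ->]; apply: Or42.
- by rewrite subrr => -[_ /x0 -> _ /y0 ->]; apply: Or43.
- by rewrite subrr => -[_ _ /x0 -> /y0 ->]; apply: Or44.
Qed.

Definition near3 r1 r2 r3 s1 s2 s3 := [/\ r1 =~ s1, r2 =~ s2 & r3 =~ s3].

Lemma near_half_sums r1 r2 r3 x0 s1 s2 s3 z0 :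
  hpa r1 r2 r3 x0 -> hpb s1 s2 s3 z0 -> near3 r1 r2 r3 s1 s2 s3 ->
  [/\ r1 + r2 =~ s1 + s2, r1 + r3 =~ s1 + s3 & r2 + r3 =~ s2 + s3] /\
  [/\ r1 - r2 =~ s1 - s2, r1 - r3 =~ s1 - s3 & r2 - r3 =~ s2 - s3].
Proof.
move=> hr hs [h1 h2 h3].
have [[p12 p13 p23] [m12 m13 m23]] := half_param_neq a12 a13 a23 hr.
case: hr hs => ea1 ea2 ea3 [eb1 eb2 eb3].
have F (r s t u : L) : r =~ t -> s =~ u -> r + s != 0 -> r - s != 0 ->
    x0 - r ^+ 2 - (x0 - s ^+ 2) =~ z0 - t ^+ 2 - (z0 - u ^+ 2) ->
    r + s =~ t + u /\ r - s =~ t - u.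
  move=> hr hs n1 n2 h; apply: (near_addB_mul vw w2) => //; last by rewrite mulf_neq0.
  have -> : (r + s) * (r - s) = - (x0 - r ^+ 2 - (x0 - s ^+ 2)) by ring.
  have -> : (t + u) * (t - u) = - (z0 - t ^+ 2 - (z0 - u ^+ 2)) by ring.
  exact: near_opp.
have [|? ?] := F _ _ _ _ h1 h2 p12 m12; first by rewrite -ea1 -ea2 -eb1 -eb2.
have [|? ?] := F _ _ _ _ h1 h3 p13 m13; first by rewrite -ea1 -ea3 -eb1 -eb3.
have [|? ?] := F _ _ _ _ h2 h3 p23 m23; first by rewrite -ea2 -ea3 -eb2 -eb3.
by [].
Qed.

Lemma pt_coord (c1 c2 c3 l r1 r2 r3 x0 : L) (x := x0 + r1 * r2 + r1 * r3 + r2 * r3) :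
  l != 0 -> half_param c1 c2 c3 r1 r2 r3 x0 ->
  [/\ x - c1 = (r1 + r2) * (r1 + r3), x - c2 = (r1 + r2) * (r2 + r3),
      x - c3 = (r1 + r3) * (r2 + r3) &
      l * ((r1 + r2) * (r1 + r3) * (r2 + r3)) / l =
      (r1 + r2) * (r1 + r3) * (r2 + r3)].
Proof. by move=> l0 [-> -> ->]; rewrite /x; split; [ring|ring|ring|field]. Qed.

Lemma near_pt_of_sums r1 r2 r3 x0 s1 s2 s3 z0 :
  hpa r1 r2 r3 x0 -> hpb s1 s2 s3 z0 ->
  r1 + r2 =~ s1 + s2 -> r1 + r3 =~ s1 + s3 -> r2 + r3 =~ s2 + s3 ->
  nearP (half_pt k r1 r2 r3 x0) (half_pt k' s1 s2 s3 z0).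
Proof.
move=> hr hs h12 h13 h23; rewrite /half_pt /=.
have [-> -> -> ->] := pt_coord k0 hr; have [-> -> -> ->] := pt_coord k0' hs.
by split; do ?apply: near_mul.
Qed.

Lemma near_pt r1 r2 r3 x0 s1 s2 s3 z0 :
  hpa r1 r2 r3 x0 -> hpb s1 s2 s3 z0 -> near3 r1 r2 r3 s1 s2 s3 ->
  nearP (half_pt k r1 r2 r3 x0) (half_pt k' s1 s2 s3 z0).
Proof.
move=> hr hs h; have [[? ? ?] _] := near_half_sums hr hs h.
exact: near_pt_of_sums.
Qed.

Lemma corresp_dpt n r1 r2 r3 x0 s1 s2 s3 z0 :
  hpa r1 r2 r3 x0 -> hpb s1 s2 s3 z0 ->
  M n (double_pt k r1 r2 r3 x0) (double_pt k' s1 s2 s3 z0) ->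
  [/\ r1 ^+ 2 =~ s1 ^+ 2, r2 ^+ 2 =~ s2 ^+ 2, r3 ^+ 2 =~ s3 ^+ 2
    & r1 * r2 * r3 =~ s1 * s2 * s3].
Proof.
move=> [ea1 ea2 ea3] [eb1 eb2 eb3] /corresp_near /=.
by rewrite ea1 ea2 ea3 eb1 eb2 eb3 !subKr ![_ * (_ * _ * _)]mulrC !mulfK.
Qed.

(** P' has its own parameters s_i. The doubles show that r_i^2 is near s_i^2 and that the products
    are near; the points themselves settle the signs. *)
Lemma corresp_pt n r1 r2 r3 x0 P' : hpa r1 r2 r3 x0 ->
  M n.+1 (half_pt k r1 r2 r3 x0) P' ->
  exists s1 s2 s3 z0, [/\ P' = half_pt k' s1 s2 s3 z0, hpb s1 s2 s3 z0,
    near3 r1 r2 r3 s1 s2 s3 & M n (double_pt k r1 r2 r3 x0) (double_pt k' s1 s2 s3 z0)].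
Proof.
move=> hr [_ oP' hn]; rewrite dbl_pt // => hM.
have [[p12 p13 p23] _] := half_param_neq a12 a13 a23 hr.
case: P' oP' hn hM => [|x y] oP' //; rewrite {1}/near_point {1}/half_pt.
case: (pt_coord k0 hr) => -> -> -> -> [h1 h2 h3 hy] hM.
have y0 : y != 0.
  have : y / k' != 0 by rewrite -(near0 vw hy) !mulf_neq0.
  by rewrite mulf_eq0 negb_or => /andP[].
have [s1 [s2 [s3 [z0 [hs es]]]]] := on_pt_exists two0 oP' y0.
rewrite es in hM; case: es h1 h2 h3 hy => -> ->.
case: (pt_coord k0' hs) => -> -> -> -> h1 h2 h3 hy.
rewrite dbl_pt // in hM.
have [q1 q2 q3 q] := corresp_dpt hr hs hM.
exists s1, s2, s3, z0; split=> //.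
(* Each sum r_i + r_j is y / k divided by x - a_l, with l the third index, hence near its
   counterpart. *)
apply: (near_halves vw w2 a12 a13 a23 n12 n13 n23 hr hs) => //.
- by apply: near_mulI h3 _ => //; rewrite ?mulf_neq0 // mulrC mulrA [X in _ =~ X]mulrC mulrA.
- by apply: near_mulI h2 _ => //; rewrite ?mulf_neq0 // mulrAC [X in _ =~ X]mulrAC.
- by apply: near_mulI h1 _ => //; rewrite mulf_neq0.
Qed.

Lemma corresp_total n P : on_curve g P -> iter n (fun Q => Q +e Q) P = Infinity ->
  exists P', M n P P'.
Proof.
elim: n P => [|n IH] P oP; first by move=> /= ->; exists Infinity.
rewrite iterSr => e; have [Q' hQ] := IH _ (onD oP oP) e.
have [/order2_pair_exists [T' t]|] := on_curve_cases k0 two0 oP.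
  by exists T'; apply: order2_pair_corresp.
case=> [r1 [r2 [r3 [x0 [hr eP]]]]]; rewrite eP dbl_pt // in hQ.
have [_ oQ'] := corresp_on hQ.
have := corresp_near hQ; case: Q' hQ oQ' => [|z0 y0] hQ oQ' //= [].
case: (hr) => {1}-> {1}-> {1}->; rewrite !subKr => h1 h2 h3 hy.
have [s1 e1 n1] := near_sqrt vw (near_sym vw h1).
have [s2 e2 n2] := near_sqrt vw (near_sym vw h2).
have [s3 e3 n3] := near_sqrt vw (near_sym vw h3).
have hs : hpb s1 s2 s3 z0 by split; rewrite ?e1 ?e2 ?e3 subKr.
(* The chosen roots might produce the opposite of the given point; the ordinates being near, this
   happens only when they vanish. *)
have eQ : Affine z0 y0 = double_pt k' s1 s2 s3 z0.
  have oD : on_curve g' (double_pt k' s1 s2 s3 z0).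
    by rewrite /= cubicE -e1 -e2 -e3; ring.
  case: (on_same_x oQ' oD) => [->//|ey].
  move: hy; rewrite ey mulNr ![_ * (_ * _ * _)]mulrC !mulfK // => hy.
  have hs' : r1 * r2 * r3 =~ s1 * s2 * s3.
    by apply: (near_mul vw (near_mul vw _ _)); apply: near_sym.
  by rewrite /double_pt (near_oppN vw w2 hs' hy) mul0r mulr0 oppr0.
exists (half_pt k' s1 s2 s3 z0); split.
- exact: oP.
- exact: on_pt.
- by rewrite eP; apply: near_pt => //; split; apply: near_sym.
- by rewrite eP !dbl_pt // -eQ.
Qed.

Lemma order2_pair_uniq T T' T'' : T2 T T' -> T2 T T'' -> T' = T''.
Proof.
case=> -[-> ->] [] [e ->] //; case: e => e; exfalso.
all: by move: a12 a13 a23; rewrite e ?eqxx.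
Qed.

(** By induction the doubles coincide, so the parameters agree up to signs, and nearness to the same
    r_i fixes each sign. *)
Lemma corresp_uniq n P P' P'' : M n P P' -> M n P P'' -> P' = P''.
Proof.
elim: n P P' P'' => [|n IH] P P' P''; first by case=> _ -> [_ ->].
move=> h h'; have [oP oP'] := corresp_on h; have [_ oP''] := corresp_on h'.
have [t|] := on_curve_cases k0 two0 oP.
  exact: order2_pair_uniq (near_order2_pair t oP' (corresp_near h))
                          (near_order2_pair t oP'' (corresp_near h')).
case=> [r1 [r2 [r3 [x0 [hr eP]]]]]; rewrite eP in h h'.
have [s1 [s2 [s3 [z0 [-> hs [p1 p2 p3] hM]]]]] := corresp_pt hr h.
have [t1 [t2 [t3 [y0 [-> ht [q1 q2 q3] hM']]]]] := corresp_pt hr h'.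
have [ez _] := IH _ _ _ hM hM'; rewrite -{}ez in ht *.
have F (r s t b : L) : r =~ s -> r =~ t -> b = z0 - s ^+ 2 -> b = z0 - t ^+ 2 -> s = t.
  move=> h1 h2 -> /addrI/oppr_inj/eqP; rewrite eqf_sqr => /orP[/eqP //|/eqP e].
  rewrite e in h1; have := near_oppN vw w2 h2 h1 => t0.
  by rewrite e t0 oppr0.
case: hs ht => e1 e2 e3 [f1 f2 f3].
by rewrite (F _ _ _ _ p1 q1 e1 f1) (F _ _ _ _ p2 q2 e2 f2) (F _ _ _ _ p3 q3 e3 f3).
Qed.

Lemma corresp_opp n P P' : M n P P' -> M n (opp_point P) (opp_point P').
Proof.
elim: n P P' => [|n IH] P P'; first by case=> -> ->.
case=> oP oP' h hM; split; try exact: on_opp.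
  case: P P' h {oP oP' hM} => [|x y] [|x' y'] //= [? ? ? ?]; split=> //.
  by rewrite !mulNr; apply: near_opp.
by rewrite !opp_point_add //; apply: IH.
Qed.

Lemma order2_pair_add S S' T T' : T2 S S' -> T2 T T' -> T2 (S +e T) (S' +f T').
Proof.
have e12 (c1 c2 c3 : L) : c1 + c2 + c3 - c1 - c2 = c3 by ring.
have e21 (c1 c2 c3 : L) : c1 + c2 + c3 - c2 - c1 = c3 by ring.
have e13 (c1 c2 c3 : L) : c1 + c2 + c3 - c1 - c3 = c2 by ring.
have e31 (c1 c2 c3 : L) : c1 + c2 + c3 - c3 - c1 = c2 by ring.
have e23 (c1 c2 c3 : L) : c1 + c2 + c3 - c2 - c3 = c1 by ring.
have e32 (c1 c2 c3 : L) : c1 + c2 + c3 - c3 - c2 = c1 by ring.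
have add0 (c : {poly L}) P : add_point c Infinity P = P by [].
case=> -[-> ->] [] [-> ->]; rewrite ?add_pt0 ?add_point0 ?add0;
  do ?first [by apply: Or41|by apply: Or42|by apply: Or43|by apply: Or44].
all: rewrite add_order2 // 1?eq_sym // add_order2 // 1?eq_sym // !(e12, e21, e13, e31, e23, e32).
all: first [by apply: Or42|by apply: Or43|by apply: Or44].
Qed.

Lemma near_add_order2 n Q Q' T T' : M n.+1 Q Q' -> T2 T T' ->
  nearP (Q +e T) (Q' +f T').
Proof.
move=> h t; have [oQ oQ'] := corresp_on h.
have [tQ|] := on_curve_cases k0 two0 oQ.
  apply/order2_pair_near/order2_pair_add => //.
  exact: near_order2_pair tQ oQ' (corresp_near h).
case=> [r1 [r2 [r3 [x0 [hr eQ]]]]]; rewrite eQ in h *.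
have [s1 [s2 [s3 [z0 [-> hs [p1 p2 p3] _]]]]] := corresp_pt hr h.
case: t => -[-> ->].
- by rewrite !add_point0; apply: near_pt.
- rewrite !add_pt_T1 //; apply: near_pt.
  + by case: hr => -> -> ->; split; rewrite ?sqrrN.
  + by case: hs => -> -> ->; split; rewrite ?sqrrN.
  + by split=> //; apply: near_opp.
- rewrite !add_pt_T2 //; apply: near_pt.
  + by case: hr => -> -> ->; split; rewrite ?sqrrN.
  + by case: hs => -> -> ->; split; rewrite ?sqrrN.
  + by split=> //; apply: near_opp.
- rewrite !add_pt_T3 //; apply: near_pt.
  + by case: hr => -> -> ->; split; rewrite ?sqrrN.
  + by case: hs => -> -> ->; split; rewrite ?sqrrN.
  + by split=> //; apply: near_opp.
Qed.

Lemma corresp_add_order2 n Q Q' T T' : M n.+1 Q Q' -> T2 T T' ->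
  M n.+1 (Q +e T) (Q' +f T').
Proof.
move=> h t; have [oQ oQ'] := corresp_on h.
have [oT eT] := (order2_on k (order2_pair_l t), order2_opp (order2_pair_l t)).
have [oT' eT'] := (order2_on k' (order2_pair_r t), order2_opp (order2_pair_r t)).
split; [exact: onD|exact: onD'|exact: near_add_order2 h t|].
by rewrite !dbl_add_order2 //; case: h.
Qed.

Definition near_abscissa_sub (P Q P' Q' : ec_point L) : Prop :=
  match P, Q, P', Q' with
  | Affine x _, Affine z _, Affine x' _, Affine z' _ => x - z =~ x' - z'
  | _, _, _, _ => True
  end.

Lemma near_abscissa_subC P Q P' Q' :
  near_abscissa_sub P Q P' Q' -> near_abscissa_sub Q P Q' P'.
Proof.
case: P Q P' Q' => [|x y] [|z t] [|x' y'] [|z' t'] //= /near_opp.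
by rewrite !opprB.
Qed.

Lemma near_abscissa_sub_opp P Q P' Q' : near_abscissa_sub P Q P' Q' ->
  near_abscissa_sub P (opp_point Q) P' (opp_point Q').
Proof. by case: P Q P' Q' => [|x y] [|z t] [|x' y'] [|z' t']. Qed.

Lemma near_abscissa_sub_order2 P P' Q Q' : order2 a1 a2 a3 P -> on_curve g' P' ->
  nearP P P' -> nearP Q Q' -> near_abscissa_sub P Q P' Q'.
Proof.
move=> t oP' /(near_order2_pair t oP') t' h; apply: near_abscissa_subC.
case: t' h => -[-> ->]; case: Q Q' => [|x y] [|x' y'] //=; by case.
Qed.

(** Translation by (a_i, 0) changes the abscissa by 2 r_i (r_j + r_l) up to sign, a product of
    factors known to be near. *)
Lemma near_abscissa_sub_add_order2 r1 r2 r3 x0 s1 s2 s3 z0 T T' :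
  hpa r1 r2 r3 x0 -> hpb s1 s2 s3 z0 -> near3 r1 r2 r3 s1 s2 s3 -> T2 T T' ->
  near_abscissa_sub (half_pt k r1 r2 r3 x0) (half_pt k r1 r2 r3 x0 +e T)
                    (half_pt k' s1 s2 s3 z0) (half_pt k' s1 s2 s3 z0 +f T').
Proof.
move=> hr hs h t; have [[h12 h13 h23] _] := near_half_sums hr hs h.
case: h => h1 h2 h3.
case: t => -[-> ->]; rewrite ?add_point0 ?add_pt_T1 ?add_pt_T2 ?add_pt_T3 //=.
- by rewrite !subrr.
- rewrite [X in X =~ _](_ : _ = 2 * r1 * (r2 + r3)); last by ring.
  rewrite [X in _ =~ X](_ : _ = 2 * s1 * (s2 + s3)); last by ring.
  by do 2?apply: (near_mul vw).
- rewrite [X in X =~ _](_ : _ = 2 * r2 * (r1 + r3)); last by ring.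
  rewrite [X in _ =~ X](_ : _ = 2 * s2 * (s1 + s3)); last by ring.
  by do 2?apply: (near_mul vw).
- rewrite [X in X =~ _](_ : _ = 2 * r3 * (r1 + r2)); last by ring.
  rewrite [X in _ =~ X](_ : _ = 2 * s3 * (s1 + s2)); last by ring.
  by do 2?apply: (near_mul vw).
Qed.

Lemma corresp_translate n P Q P' Q' T : M n.+1 P P' -> M n.+1 Q Q' ->
  order2 a1 a2 a3 T -> Q = P +e T -> exists2 T', T2 T T' & Q' = P' +f T'.
Proof.
move=> hP hQ /order2_pair_exists [T' t] e; exists T' => //.
by rewrite e in hQ; apply: corresp_uniq hQ (corresp_add_order2 hP t).
Qed.

Lemma near_pair_params r1 r2 r3 x0 s1 s2 s3 z0 r1' r2' r3' x0' s1' s2' s3' z0'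
    (D := x0 - z0) (D' := x0' - z0') (u1 := r1 - s1) (u2 := r2 - s2) (u3 := r3 - s3)
    (u1' := r1' - s1') (u2' := r2' - s2') (u3' := r3' - s3') :
  hpa r1 r2 r3 x0 -> hpa s1 s2 s3 z0 -> hpb r1' r2' r3' x0' -> hpb s1' s2' s3' z0' ->
  near3 r1 r2 r3 r1' r2' r3' -> near3 s1 s2 s3 s1' s2' s3' -> D != 0 -> D =~ D' ->
  [/\ near3 u1 u2 u3 u1' u2' u3',
      near3 (u1 + u2) (u1 + u3) (u2 + u3) (u1' + u2') (u1' + u3') (u2' + u3'),
      near3 (D + u1 * u2) (D + u1 * u3) (D + u2 * u3)
            (D' + u1' * u2') (D' + u1' * u3') (D' + u2' * u3')
    & near3 (D - u1 * u2) (D - u1 * u3) (D - u2 * u3)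
            (D' - u1' * u2') (D' - u1' * u3') (D' - u2' * u3')].
Proof.
move=> hr hs hr' hs' nr ns D0 hD.
have [d1 d2 d3] := half_param_sub hr hs; have [d1' d2' d3'] := half_param_sub hr' hs'.
have [[p12 p13 p23] [m12 m13 m23]] := half_param_neq a12 a13 a23 hr.
have [[q12 q13 q23] _] := half_param_neq a12 a13 a23 hs.
have [[np12 np13 np23] [nm12 nm13 nm23]] := near_half_sums hr hr' nr.
have [[nq12 nq13 nq23] _] := near_half_sums hs hs' ns.
case: nr ns => nr1 nr2 nr3 [ns1 ns2 ns3].
have [? ? ?] := near_half_pair vw w2 D0 hD nr1 nr2 ns1 ns2 np12 nm12 nq12 p12 m12 q12
  d1 d2 d1' d2' (erefl u1) (erefl u2) (erefl u1') (erefl u2').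
have [? ? ?] := near_half_pair vw w2 D0 hD nr1 nr3 ns1 ns3 np13 nm13 nq13 p13 m13 q13
  d1 d3 d1' d3' (erefl u1) (erefl u3) (erefl u1') (erefl u3').
have [? ? ?] := near_half_pair vw w2 D0 hD nr2 nr3 ns2 ns3 np23 nm23 nq23 p23 m23 q23
  d2 d3 d2' d3' (erefl u2) (erefl u3) (erefl u2') (erefl u3').
have ? : u1 =~ u1' := near_sub_halves vw w2 D0 hD nr1 ns1 d1 d1'.
have ? : u2 =~ u2' := near_sub_halves vw w2 D0 hD nr2 ns2 d2 d2'.
have ? : u3 =~ u3' := near_sub_halves vw w2 D0 hD nr3 ns3 d3 d3'.
by split; split.
Qed.

(** A product formula, which lets nearness descend from the abscissa difference D of the doubles to
    that of the halves. *)
Lemma pt_abscissa_sub (c1 c2 c3 r1 r2 r3 x0 s1 s2 s3 z0 : L)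
    (D := x0 - z0) (u1 := r1 - s1) (u2 := r2 - s2) (u3 := r3 - s3) :
  half_param c1 c2 c3 r1 r2 r3 x0 -> half_param c1 c2 c3 s1 s2 s3 z0 -> D != 0 ->
  x0 + r1 * r2 + r1 * r3 + r2 * r3 - (z0 + s1 * s2 + s1 * s3 + s2 * s3) =
  D * ((u1 + u2) * (u1 + u3) * (u2 + u3)) / (2 * u1 * u2 * u3).
Proof.
move=> hr hs D0; have [d1 d2 d3] := half_param_sub hr hs.
have [[m1 m2 f1 g1 _] _] := half_pair two0 D0 (erefl u1) (erefl u2) d1 d2.
have [[_ _ f2 g2 _] _] := half_pair two0 D0 (erefl u2) (erefl u1) d2 d1.
have [[m3 _ f3 g3 _] _] := half_pair two0 D0 (erefl u3) (erefl u1) d3 d1.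
have ez : z0 = x0 - D by rewrite /D; ring.
clearbody D u1 u2 u3.
rewrite ez f1 f2 f3 g1 g2 g3; field; by rewrite two0 m1 m2 m3.
Qed.

Lemma corresp_abscissa_sub n P P' Q Q' : M n P P' -> M n Q Q' ->
  near_abscissa_sub P Q P' Q'.
Proof.
elim: n P P' Q Q' => [|n IH] P P' Q Q'; first by case=> -> -> [-> ->].
move=> hP hQ; have [oP oP'] := corresp_on hP; have [oQ oQ'] := corresp_on hQ.
have [tP|[r1 [r2 [r3 [x0 [hr eP]]]]]] := on_curve_cases k0 two0 oP.
  exact: near_abscissa_sub_order2 tP oP' (corresp_near hP) (corresp_near hQ).
have hP' := hP; rewrite eP in hP'.
have [r1' [r2' [r3' [x0' [eP' hr' nr hdP]]]]] := corresp_pt hr hP'.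
have [[t|t]|[T t e]|[T t e]|] := dbl_add_cases k0 two0 a12 a13 a23 oP oQ.
- exact: near_abscissa_sub_order2 t oP' (corresp_near hP) (corresp_near hQ).
- apply: near_abscissa_subC.
  exact: near_abscissa_sub_order2 t oQ' (corresp_near hQ) (corresp_near hP).
- have [T' t' e'] := corresp_translate hP hQ t e.
  by rewrite e e' eP eP'; apply: near_abscissa_sub_add_order2 hr hr' nr t'.
- have [T' t' e'] := corresp_translate (corresp_opp hP) hQ t e.
  (* Abscissas ignore signs: -P + T = -(P + T) may be replaced by P + T. *)
  rewrite e e' -(order2_opp t) -(order2_opp (order2_pair_r t')).
  have oT := order2_on k t; have oT' := order2_on k' (order2_pair_r t').
  rewrite !opp_point_add //; apply: near_abscissa_sub_opp.
  by rewrite eP eP'; apply: near_abscissa_sub_add_order2 hr hr' nr t'.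
- case=> p1 [p2 [p3 [y0 [s1 [s2 [s3 [z0 [hp hs ne eP2 eQ]]]]]]]].
  rewrite eP2 in hP; rewrite eQ in hQ.
  have [p1' [p2' [p3' [y0' [eP2' hp' np hdP2]]]]] := corresp_pt hp hP.
  have [s1' [s2' [s3' [z0' [eQ' hs' ns hdQ]]]]] := corresp_pt hs hQ.
  have /= hD := IH _ _ _ _ hdP2 hdQ.
  have D0 : y0 - z0 != 0 by rewrite subr_eq0.
  have D0' : y0' - z0' != 0 by rewrite -(near0 vw hD).
  have [[? ? ?] [? ? ?] _ _] := near_pair_params hp hs hp' hs' np ns D0 hD.
  rewrite eP2 eQ eP2' eQ' /= (pt_abscissa_sub hp hs D0) (pt_abscissa_sub hp' hs' D0').
  by apply: (near_div vw); do ?apply: (near_mul vw).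
Qed.

Lemma corresp_add n P P' Q Q' : M n P P' -> M n Q Q' -> M n (P +e Q) (P' +f Q').
Proof.
elim: n P P' Q Q' => [|n IH] P P' Q Q'; first by case=> -> -> [-> ->].
move=> hP hQ; have [oP oP'] := corresp_on hP; have [oQ oQ'] := corresp_on hQ.
have hdP : M n (P +e P) (P' +f P') by case: hP.
have hdQ : M n (Q +e Q) (Q' +f Q') by case: hQ.
have smooth := cubic_smooth k0 a12 a13 a23.
have smooth' := cubic_smooth k0' b12 b13 b23.
split; [exact: onD|exact: onD'| |by rewrite !dbl_add //; apply: IH].
have [[t|t]|[T t e]|[T t e]|] := dbl_add_cases k0 two0 a12 a13 a23 oP oQ.
- rewrite (add_pointC sg oP oQ) (add_pointC sg' oP' oQ').
  exact: near_add_order2 hQ (near_order2_pair t oP' (corresp_near hP)).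
- exact: near_add_order2 hP (near_order2_pair t oQ' (corresp_near hQ)).
- have [T' t' e'] := corresp_translate hP hQ t e.
  have oT := order2_on k t; have oT' := order2_on k' (order2_pair_r t').
  rewrite e e' (addAl two0 sg smooth) // (addAl two0 sg' smooth') //.
  (* [near_add_order2] needs a positive level; at level 0 the double is [Infinity] and the sum is T
     itself. *)
  case: n {IH hP hQ hdQ} hdP => [[-> ->]|n hdP]; last exact: near_add_order2 hdP t'.
  exact: order2_pair_near.
- have [T' t' e'] := corresp_translate (corresp_opp hP) hQ t e.
  have oT := order2_on k t; have oT' := order2_on k' (order2_pair_r t').
  have cancelD (c : {poly L}) S T0 : on_curve c S -> on_curve c T0 ->
      size c = 4%N -> (forall x, c.[x] = 0 -> c^`().[x] != 0) ->
      add_point c S (add_point c (opp_point S) T0) = T0.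
    move=> oS oT0 sc sm; have oN := on_opp oS; have oNT := on_add two0 sc oN oT0.
    rewrite (add_pointC sc oS oNT) (add_pointC sc oN oT0).
    by rewrite -{2}[S]opp_pointK addK.
  by rewrite e e' !cancelD //; apply: order2_pair_near.
- case=> r1 [r2 [r3 [x0 [s1 [s2 [s3 [z0 [hr hs ne eP eQ]]]]]]]].
  rewrite eP in hP; rewrite eQ in hQ.
  have [r1' [r2' [r3' [x0' [eP' hr' nr {}hdP]]]]] := corresp_pt hr hP.
  have [s1' [s2' [s3' [z0' [eQ' hs' ns {}hdQ]]]]] := corresp_pt hs hQ.
  have /= hD := corresp_abscissa_sub hdP hdQ.
  have D0 : x0 - z0 != 0 by rewrite subr_eq0.
  have D0' : x0' - z0' != 0 by rewrite -(near0 vw hD).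
  have [[? ? ?] _ [? ? ?] [? ? ?]] := near_pair_params hr hs hr' hs' nr ns D0 hD.
  have [t1 [t2 [t3 [y0 [[ht E _] [e12 e13 e23]]]]]] :=
    add_half_param k0 two0 a12 a13 a23 hr hs erefl D0 erefl erefl erefl.
  have [t1' [t2' [t3' [y0' [[ht' E' _] [e12' e13' e23']]]]]] :=
    add_half_param k0' two0 b12 b13 b23 hr' hs' erefl D0' erefl erefl erefl.
  rewrite eP eQ eP' eQ' E E'; apply: near_pt_of_sums => //;
    rewrite ?e12 ?e13 ?e23 ?e12' ?e13' ?e23';
    by apply: (near_div vw); do ?apply: (near_mul vw).
Qed.

Lemma corresp_mul n m P P' : M n P P' -> M n (mul_point g m P) (mul_point g' m P').
Proof.
move=> h; elim: m => [|m IH]; first exact: corresp_Infinity.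
by rewrite !mul_pointS; apply: corresp_add.
Qed.

End Correspondence.

(** * Uniqueness of the extended valuation *)

Section UniqueExtension.
Variables (K : fieldType) (L : fieldType) (iota : {rmorphism K -> L}).
Variables (v : K -> \bar int) (pi : K).
Hypothesis cdv : complete_discrete_valuation v pi.

Let ev (q : {poly K}) (x : L) := (map_poly iota q).[x].

Let ev_sum n (q : {poly K}) x : (size q <= n)%N -> ev q x = \sum_(i < n) iota q`_i * x ^+ i.
Proof.
move=> h; rewrite /ev (@horner_coef_wide _ n) ?size_map_poly //.
by apply: eq_bigr => i _; rewrite coef_map.
Qed.

Section OneExtension.
Variable w : L -> \bar rat.
Hypotheses (vw : valuation w) (ext : forall x, w (iota x) = er_map intr (v x)).

Lemma ext_ge (B : int) a : ((B%:~R : rat)%:E <= w (iota a))%E = (B%:E <= v a)%E.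
Proof. by rewrite ext; case: (v a) => [b| |] /=; rewrite ?leey // !lee_fin ler_int. Qed.

Lemma power_val_lower n x : exists D : rat,
  forall i, (i < n)%N -> (D%:E <= w (x ^+ i))%E.
Proof.
elim: n => [|n [D hD]]; first by exists 0.
have [E hE] : exists E : rat, (E%:E <= w (x ^+ n))%E.
  have [->|nz] := eqVneq (x ^+ n) 0; first by exists 0; rewrite (Defs.val0 vw) leey.
  by exists (fine (w (x ^+ n))); rewrite -(val_fine vw nz).
exists (Order.min D E) => i; rewrite ltnS leq_eqVlt => /orP[/eqP ->|/hD h].
  by apply: le_trans hE; rewrite lee_fin ge_min lexx orbT.
by apply: le_trans h; rewrite lee_fin ge_min lexx.
Qed.

Lemma ev_lower n x : exists D : rat, forall q : {poly K}, (size q <= n)%N ->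
  forall B : rat, (forall i, B%:E <= w (iota q`_i))%E -> ((B + D)%:E <= w (ev q x))%E.
Proof.
have [D hD] := power_val_lower n x; exists D => q sq B hB.
rewrite (ev_sum _ sq); apply: val_sum_ge => // i _.
by rewrite (Defs.valM vw) EFinD leeD // hD.
Qed.

(* On K[x] in degrees below that of x, the extended valuation is equivalent to
   the smallest valuation of the coefficients. Completeness enters to show that
   x^n is not a limit of polynomials in x of lower degree. *)
Lemma ev_upper n x : (forall q : {poly K}, (size q <= n)%N -> ev q x = 0 -> q = 0) ->
  exists C : rat, forall q : {poly K}, (size q <= n)%N ->
  forall B : rat, (B%:E <= w (ev q x))%E -> forall i, ((B - C)%:E <= w (iota q`_i))%E.
Proof.
elim: n => [|n IH] free.
  exists 0 => q; rewrite leqn0 size_poly_eq0 => /eqP -> B _ i.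
  by rewrite coef0 rmorph0 (Defs.val0 vw) leey.
have [|C hC] := IH; first by move=> q sq; apply: free; apply: leqW.
have evD (p q : {poly K}) : ev (p + q) x = ev p x + ev q x by rewrite /ev rmorphD hornerD.
have evB (p q : {poly K}) : ev (p - q) x = ev p x - ev q x by rewrite /ev rmorphB hornerD hornerN.
have evXn : ev 'X^n x = x ^+ n by rewrite /ev map_polyXn hornerXn.
have [B1 hB1] : exists B1 : rat, forall q : {poly K}, (size q <= n)%N ->
    ~~ (B1%:E <= w (x ^+ n + ev q x))%E.
  (* Otherwise x^n + y_m(x) tends to 0 for some y_m of size at most n. By induction the coefficients
     of the y_m are Cauchy sequences, and their limits give a relation x^n + q(x) = 0, excluded by
     [free]. *)
  apply: contrapT => /forallNP no.
  have {}no (m : nat) : exists q : {poly K}, (size q <= n)%N /\ (m%:R%:E <= w (x ^+ n + ev q x))%E.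
    apply: contrapT => /forallNP h; apply: (no m%:R) => q sq.
    by apply/negP => hq; apply: (h q).
  have [y hy] := choice no.
  have close i j m : (m <= i)%N -> (m <= j)%N -> forall l,
      ((m%:R - C)%:E <= w (iota (y i - y j)`_l))%E.
    move=> mi mj; apply: hC.
      rewrite (leq_trans (size_polyD _ _)) // size_polyN geq_max.
      by have [-> _] := hy i; have [-> _] := hy j.
    rewrite evB.
    have -> : ev (y i) x - ev (y j) x = (x ^+ n + ev (y i) x) - (x ^+ n + ev (y j) x) by ring.
    apply: valB_ge => //.
      by have [_ h] := hy i; apply: le_trans h; rewrite lee_fin ler_nat.
    by have [_ h] := hy j; apply: le_trans h; rewrite lee_fin ler_nat.
  have arch (z : rat) : exists m : nat, z <= m%:R.
    by exists (Num.truncn `|z|).+1; rewrite (le_trans (ler_norm z)) // ltW // truncnS_gt.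
  have lim l : exists a, limit_seq v (fun i => (y i)`_l) a.
    apply: (cdv_complete cdv) => B; have [m hm] := arch (B%:~R + C).
    exists m => i j mi mj; rewrite -coefB -ext_ge.
    by apply: le_trans (close _ _ _ mi mj l); rewrite lee_fin lerBrDr.
  have [a ha] := choice lim.
  pose q := \poly_(l < n) a l.
  have sq : (size q <= n)%N := size_poly _ _.
  have [D hD] := ev_lower n x.
  have : ev ('X^n + q) x = 0.
    apply: (val_eq0 vw) => B.
    have [m hm] := arch B; have [m' hm'] := arch (B - D).
    have [M hM] : exists M, forall l, (l < n)%N -> forall i, (M <= i)%N ->
        ((m'%:Z)%:E <= v ((y i)`_l - a l)%R)%E.
      elim: (n) => [|k [M hM]]; first by exists 0%N.
      have [M' hM'] := ha k m'%:Z; exists (maxn M M') => l.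
      rewrite ltnS leq_eqVlt => /orP[/eqP ->|lk] i; rewrite geq_max => /andP[h h'].
        exact: hM'.
      exact: hM.
    pose i := maxn m M; have [syi hyi] := hy i.
    have -> : ev ('X^n + q) x = (x ^+ n + ev (y i) x) - ev (y i - q) x.
      by rewrite [LHS]evD evXn evB; ring.
    apply: valB_ge => //.
      apply: le_trans hyi; rewrite lee_fin (le_trans hm) // ler_nat leq_maxl //.
    apply: (le_trans _ (hD _ _ m'%:R _)).
    - by rewrite lee_fin -lerBlDr.
    - rewrite (leq_trans (size_polyD _ _)) // size_polyN geq_max syi; exact: sq.
    - move=> l; have [ln|nl] := ltnP l n; last first.
        rewrite coefB [(y i)`_l]nth_default ?(leq_trans syi) // nth_default ?(leq_trans sq) //.
        by rewrite subrr rmorph0 (Defs.val0 vw) leey.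
      have := hM l ln i (leq_maxr _ _); rewrite -ext_ge.
      by rewrite coefB coef_poly ln.
  have sX : (size ('X^n + q)%R <= n.+1)%N.
    by rewrite (leq_trans (size_polyD _ _)) // size_polyXn geq_max leqnn leqW.
  move/(free _ sX) => /(congr1 (fun p : {poly K} => p`_n)).
  rewrite coefD coefXn eqxx coef0 nth_default ?addr0 //.
  by move/eqP; rewrite oner_eq0.
have [D hD] := power_val_lower n.+1 x; have {hD} hDn := hD n (leqnn _).
(* The leading coefficient c loses at most B1, so c x^n has valuation at least B - B1 + D. Removing
   this term leaves at least B - C1, and the induction hypothesis loses C more. *)
pose C1 := Order.max 0 (B1 - D).
exists (Order.max B1 (C1 + C)) => q sq B hB.
pose c := q`_n; pose q0 := take_poly n q.
have sq0 : (size q0 <= n)%N := size_take_poly _ _.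
have eq : ev q x = iota c * x ^+ n + ev q0 x.
  rewrite (ev_sum _ sq) big_ord_recr /= addrC (ev_sum _ sq0); congr (_ + _).
  by apply: eq_bigr => i _; rewrite coef_take_poly ltn_ord.
have hc : ((B - B1)%:E <= w (iota c))%E.
  have [->|c0] := eqVneq c 0; first by rewrite rmorph0 (Defs.val0 vw) leey.
  have ic0 : iota c != 0 by rewrite fmorph_eq0.
  have := hB1 (c^-1 *: q0) (leq_trans (size_scale_leq _ _) sq0); rewrite -ltNge.
  have -> : ev (c^-1 *: q0) x = (iota c)^-1 * ev q0 x.
    by rewrite /ev map_polyZ hornerZ fmorphV.
  have {eq} eq : ev q x = iota c * (x ^+ n + (iota c)^-1 * ev q0 x).
    by rewrite eq mulrDr mulVKf.
  move: hB; rewrite eq (Defs.valM vw) (val_fine vw ic0); case: (w (_ + _)) => // r.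
  by rewrite -EFinD !lee_fin lte_fin; lra.
have hq0 : ((B - C1)%:E <= w (ev q0 x))%E.
  have -> : ev q0 x = ev q x - iota c * x ^+ n by rewrite eq; ring.
  apply: valB_ge => //.
    by apply: le_trans hB; rewrite lee_fin gerBl le_max lexx.
  rewrite (Defs.valM vw); apply: (@le_trans _ _ ((B - B1)%:E + D%:E)%E); last exact: leeD.
  rewrite -EFinD lee_fin; have : B1 - D <= C1 by rewrite le_max lexx orbT.
  lra.
move=> i; have [ni|] := ltnP i n.
  have := hC _ sq0 _ hq0 i; rewrite coef_take_poly ni; apply: le_trans.
  rewrite lee_fin; have : C1 + C <= Order.max B1 (C1 + C) by rewrite le_max lexx orbT.
  lra.
rewrite leq_eqVlt => /orP[/eqP <-|ni].
  by apply: le_trans hc; rewrite lee_fin lerB // le_max lexx.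
by rewrite nth_default ?(leq_trans sq) // rmorph0 (Defs.val0 vw) leey.
Qed.
End OneExtension.

(* Reduce x^k modulo the minimal polynomial of x: the coefficients have valuation
   at least k w(x) - C, whence W(x^k) >= k w(x) - C' for all k. *)
Lemma extension_le (w W : L -> \bar rat) x :
  valuation w -> (forall a, w (iota a) = er_map intr (v a)) ->
  valuation W -> (forall a, W (iota a) = er_map intr (v a)) ->
  algebraicOver iota x -> (w x <= W x)%E.
Proof.
have contra_lin (r s c d : rat) : r - c + d <= s -> c - d < r - s -> False.
  by move=> h1 h2; lra.
move=> vw extw vW extW [p p0 px].
have [->|x0] := eqVneq x 0; first by rewrite (Defs.val0 vW) leey.
pose kills n := `[< exists f : {poly K}, [/\ f != 0, size f = n & ev f x = 0] >].
have ex : exists n, kills n by exists (size p); apply/asboolP; exists p; split=> //; apply/rootP.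
have [m /asboolP[f [f0 sf fx]] min] := ex_minnP ex.
have m0 : (0 < m)%N by rewrite -sf size_poly_gt0.
have free (q : {poly K}) : (size q <= m.-1)%N -> ev q x = 0 -> q = 0.
  move=> sq qx; apply/eqP/negPn/negP => q0.
  have /min : kills (size q) by apply/asboolP; exists q.
  by rewrite leqNgt (leq_ltn_trans sq) // prednK.
have [C hC] := ev_upper vw extw free; have [D hD] := ev_lower vW m.-1 x.
have valE (V : L -> \bar rat) k : valuation V -> V (x ^+ k) = (fine (V x) * k%:R)%:E.
  move=> vV; elim: k => [|k IH]; first by rewrite mulr0 valuation1.
  by rewrite exprS (Defs.valM vV) IH {1}(val_fine vV x0) -EFinD -natr1 mulrDr mulr1 addrC.
rewrite (val_fine vw x0) (val_fine vW x0) lee_fin leNgt; apply/negP => lt.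
set a := fine (w x) in lt; set b := fine (W x) in lt.
(* For this k, k (a - b) > C - D, whereas the two estimates give k b >= k a - C + D. *)
pose k := (Num.truncn `|(C - D) / (a - b)|).+1.
pose q := 'X^k %% f.
have sq : (size q <= m.-1)%N by rewrite -ltnS prednK // -sf ltn_modp.
have qx : ev q x = x ^+ k.
  have -> : q = 'X^k - 'X^k %/ f * f by rewrite [X in X - _](divp_eq _ f) addrAC subrr add0r.
  rewrite /ev rmorphB rmorphM hornerD hornerN hornerM /= -/(ev f x) fx mulr0 subr0.
  by rewrite map_polyXn hornerXn.
have h1 : ((a * k%:R)%:E <= w (ev q x))%E by rewrite qx valE.
have h2 i : ((a * k%:R - C)%:E <= W (iota q`_i))%E by rewrite extW -extw; apply: hC.
have := hD q sq _ h2; rewrite qx valE // lee_fin -/b => h3.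
have ab : 0 < a - b by rewrite subr_gt0.
have : (C - D) / (a - b) < k%:R by rewrite (le_lt_trans (ler_norm _)) // truncnS_gt.
by rewrite ltr_pdivrMr // mulrBr ![k%:R * _]mulrC; apply: contra_lin h3.
Qed.

Lemma extension_uniq (w W : L -> \bar rat) x :
  valuation w -> (forall a, w (iota a) = er_map intr (v a)) ->
  valuation W -> (forall a, W (iota a) = er_map intr (v a)) ->
  algebraicOver iota x -> w x = W x.
Proof. by move=> *; apply/eqP; rewrite eq_le !extension_le. Qed.
End UniqueExtension.

Lemma gal_val (K : fieldType) (L : closedFieldType) (iota : {rmorphism K -> L})
    (v : K -> \bar int) (pi : K) (w : L -> \bar rat) (s : absolute_galois iota) x :
  complete_discrete_valuation v pi -> extends_valuation iota v w ->
  algebraic_closure iota -> w (s x) = w x.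
Proof.
move=> cdv [vw ext] alg; apply: (@extension_uniq _ _ iota v pi cdv (w \o s) w) => //=.
- case: vw => v0 vf vM vD; split=> /=.
  + by rewrite rmorph0.
  + by move=> y y0; apply: vf; rewrite fmorph_eq0.
  + by move=> y z; rewrite rmorphM.
  + by move=> y z; rewrite rmorphD.
- by move=> a; rewrite gal_fix.
Qed.

(** * Tate modules *)

Section TateModules.
Variables (L : closedFieldType) (R : realDomainType) (w : L -> \bar R).
Hypotheses (vw : valuation w) (w2 : ~~ (0 < w 2)%E).
Local Notation "x =~ y" := (near w x y) (at level 70).
Variables (k k' a1 a2 a3 b1 b2 b3 : L).
Hypotheses (k0 : k != 0) (k0' : k' != 0).
Hypotheses (a12 : a1 != a2) (a13 : a1 != a3) (a23 : a2 != a3).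
Hypotheses (n12 : a1 - a2 =~ b1 - b2) (n13 : a1 - a3 =~ b1 - b3)
  (n23 : a2 - a3 =~ b2 - b3).
Let two0 := two_neq0 vw w2.
Let b12 : b1 != b2. Proof. by rewrite -subr_eq0 -(near0 vw n12) subr_eq0. Qed.
Let b13 : b1 != b3. Proof. by rewrite -subr_eq0 -(near0 vw n13) subr_eq0. Qed.
Let b23 : b2 != b3. Proof. by rewrite -subr_eq0 -(near0 vw n23) subr_eq0. Qed.

Local Notation g := (cubic k a1 a2 a3).
Local Notation g' := (cubic k' b1 b2 b3).
Local Notation M := (corresp w k k' a1 a2 a3 b1 b2 b3).
Let tateP := tate2P k0 two0 a12 a13 a23.
Let tateP' := tate2P k0' two0 b12 b13 b23.

Let uniq_right n P P' P'' : M n P P' -> M n P P'' -> P' = P''.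
Proof. exact: (corresp_uniq vw w2 k0 k0' a12 a13 a23 n12 n13 n23). Qed.

Lemma tate2_iter_dbl P n : tate2 g P ->
  iter n (fun Q => add_point g Q Q) (P n) = Infinity.
Proof.
by move=> /tateP[P0 hP]; elim: n => // n IH; rewrite iterSr; have [_ ->] := hP n.
Qed.

Lemma tate2_corresp P n : tate2 g P -> exists P', M n (P n) P'.
Proof.
move=> tP; apply: (corresp_total vw w2 k0 k0' a12 a13 a23 n12 n13 n23).
  by have /tateP[_ hP] := tP; have [] := hP n.
exact: tate2_iter_dbl.
Qed.

(** The double of P'_(n+1) and the point P'_n both correspond to P_n, so they coincide. *)
Lemma corresp_tate2 P P' : tate2 g P -> (forall n, M n (P n) (P' n)) -> tate2 g' P'.
Proof.
move=> /tateP[P0 hP] h; apply/tateP'; split; first by case: (h 0%N).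
move=> n; have [_ oP'] := corresp_on (h n); split=> //.
have [_ _ _] := h n.+1; have [_ ->] := hP n => h'.
exact: uniq_right h' (h n).
Qed.

End TateModules.

Section Isomorphism.
Variables (L : closedFieldType) (R : realDomainType) (w : L -> \bar R).
Hypotheses (vw : valuation w) (w2 : ~~ (0 < w 2)%E).
Local Notation "x =~ y" := (near w x y) (at level 70).
Variables (k k' a1 a2 a3 b1 b2 b3 : L).
Hypotheses (k0 : k != 0) (k0' : k' != 0).
Hypotheses (a12 : a1 != a2) (a13 : a1 != a3) (a23 : a2 != a3).
Hypotheses (n12 : a1 - a2 =~ b1 - b2) (n13 : a1 - a3 =~ b1 - b3)
  (n23 : a2 - a3 =~ b2 - b3).
Let two0 := two_neq0 vw w2.
Let b12 : b1 != b2. Proof. by rewrite -subr_eq0 -(near0 vw n12) subr_eq0. Qed.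
Let b13 : b1 != b3. Proof. by rewrite -subr_eq0 -(near0 vw n13) subr_eq0. Qed.
Let b23 : b2 != b3. Proof. by rewrite -subr_eq0 -(near0 vw n23) subr_eq0. Qed.
Local Notation g := (cubic k a1 a2 a3).
Local Notation g' := (cubic k' b1 b2 b3).
Local Notation M := (corresp w k k' a1 a2 a3 b1 b2 b3).

Lemma tate2_isomorphic_corresp (K : fieldType) (iota : {rmorphism K -> L}) :
  (forall s : absolute_galois iota, forall n P P',
     M n P P' -> M n (map_point s P) (map_point s P')) ->
  (forall (s : absolute_galois iota) P, tate2 g P -> tate2 g (tate_act s P)) ->
  tate2_isomorphic iota g g'.
Proof.
move=> equiv act_closed.
(* Choice is made over pairs of a sequence and a level; outside the Tate module [Infinity] is a
   dummy value. *)
have ex (x : (nat -> ec_point L) * nat) : exists P', tate2 g x.1 -> M x.2 (x.1 x.2) P'.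
  case: x => P n /=; have [tP|nP] := pselect (tate2 g P); last by exists Infinity.
  have [P' h] := tate2_corresp vw w2 k0 k0' a12 a13 a23 n12 n13 n23 n tP.
  by exists P'.
have [phi hphi0] := choice ex.
have hphi P n : tate2 g P -> M n (P n) (phi (P, n)).
  by move=> tP; apply: (hphi0 (P, n)).
(* Each identity for the isomorphism now reduces to the correspondence being preserved level by
   level. *)
have uniq P P' : tate2 g P -> (forall n, M n (P n) (P' n)) ->
    (fun n => phi (P, n)) = P'.
  move=> tP h; apply/funext => n.
  exact: (corresp_uniq vw w2 k0 k0' a12 a13 a23 n12 n13 n23 (hphi P n tP) (h n)).
have m12 := near_sym vw n12; have m13 := near_sym vw n13; have m23 := near_sym vw n23.
exists (fun P n => phi (P, n)); split.
- split.
  + move=> P tP; apply: (corresp_tate2 vw w2 k0 k0' a12 a13 a23 n12 n13 n23 tP).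
    by move=> n; apply: hphi.
  + move=> P Q /set_mem tP /set_mem tQ e; apply/funext => n.
    have h := hphi _ n tP; have h' := hphi _ n tQ.
    rewrite (congr1 (fun f => f n) e) in h.
    exact: (corresp_uniq vw w2 k0' k0 b12 b13 b23 m12 m13 m23
      (corresp_sym vw h) (corresp_sym vw h')).
  + move=> Q tQ.
    have /choice [P hP] n : exists P, M n P (Q n).
      have [P h] := tate2_corresp vw w2 k0' k0 b12 b13 b23 m12 m13 m23 n tQ.
      by exists P; apply: (corresp_sym vw).
    have tP : tate2 g P.
      apply: (corresp_tate2 vw w2 k0' k0 b12 b13 b23 m12 m13 m23 tQ) => n.
      exact: (corresp_sym vw).
    by exists P => //; apply: uniq.
- move=> P Q tP tQ; apply: uniq => [|n]; first exact: tate_add_closed.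
  by apply: corresp_add => //; apply: hphi.
- move=> z P tP; apply: uniq => [|n]; first exact: tate_scale_closed.
  by apply: corresp_mul => //; apply: hphi.
- move=> s P tP; apply: uniq => [|n]; first exact: act_closed.
  by apply: equiv; apply: hphi.
Qed.
End Isomorphism.

(** * Galois equivariance *)

Section Conjugation.
Variables (L : fieldType) (s : {rmorphism L -> L}) (g : {poly L}).
Hypothesis fix_g : map_poly s g = g.

Lemma fixed_coef i : s g`_i = g`_i.
Proof. by rewrite -{2}fix_g coef_map. Qed.

Lemma fixed_horner x : s g.[x] = g.[s x].
Proof. by rewrite -{2}fix_g horner_map. Qed.

Lemma fixed_horner_deriv x : s g^`().[x] = g^`().[s x].
Proof. by rewrite -{2}fix_g deriv_map horner_map. Qed.

Lemma map_point_on P : on_curve g P -> on_curve g (map_point s P).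
Proof. by case: P => //= x y e; rewrite -rmorphXn e fixed_horner. Qed.

Lemma map_point_chord l x1 y1 x2 :
  map_point s (chord g l x1 y1 x2) = chord g (s l) (s x1) (s y1) (s x2).
Proof.
rewrite /chord /=; congr Affine;
  by rewrite ?(rmorphN, rmorphD, rmorphM, rmorphB, fmorphV, rmorphXn, fixed_coef) /= ?fixed_coef.
Qed.

Lemma map_point_add P Q :
  map_point s (add_point g P Q) = add_point g (map_point s P) (map_point s Q).
Proof.
case: P Q => [|x1 y1] [|x2 y2] //; rewrite /add_point /=.
have sI x y : (s x == s y) = (x == y) := inj_eq (fmorph_inj s) x y.
rewrite sI -(rmorphN s y2) sI.
case: ifP => _.
  by rewrite map_point_chord fmorph_div !rmorphB.
by case: ifP => _ //; rewrite map_point_chord fmorph_div fixed_horner_deriv rmorphMn.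
Qed.

Lemma map_point_mul n P :
  map_point s (mul_point g n P) = mul_point g n (map_point s P).
Proof. by elim: n => //= n <-; rewrite -map_point_add. Qed.

Lemma map_point_tate2 P : tate2 g P -> tate2 g (fun n => map_point s (P n)).
Proof.
move=> h n; have [[oP tP] eP] := h n.
by split; [split; [exact: map_point_on|] |]; rewrite -map_point_mul ?tP ?eP.
Qed.
End Conjugation.

Section Equivariance.
Variables (L : closedFieldType) (R : realDomainType) (w : L -> \bar R).
Variable s : {rmorphism L -> L}.
Hypothesis s_val : forall x, w (s x) = w x.
Variables (k k' a1 a2 a3 b1 b2 b3 : L).
Local Notation g := (cubic k a1 a2 a3).
Local Notation g' := (cubic k' b1 b2 b3).
Local Notation M := (corresp w k k' a1 a2 a3 b1 b2 b3).

Definition root_pair a b :=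
  [\/ a = a1 /\ b = b1, a = a2 /\ b = b2 | a = a3 /\ b = b3].

Hypotheses (fix_g : map_poly s g = g) (fix_g' : map_poly s g' = g').
Hypothesis s_pairs : forall a b, root_pair a b ->
  exists a0 b0, [/\ root_pair a0 b0, s a0 = a & s b0 = b].
Hypothesis s_scalars : (s k = k /\ s k' = k') \/ (s k = - k /\ s k' = - k').

Lemma near_conj x y : near w x y -> near w (s x) (s y).
Proof.
case=> u h ->; exists (s u); last by rewrite rmorphM.
by rewrite -(rmorph1 s) -rmorphB s_val.
Qed.

(** Quantifying over the pairs of roots makes the condition invariant under any permutation of the
    pairs. *)
Lemma near_point_pairs x y x' y' :
  near_point w k k' a1 a2 a3 b1 b2 b3 (Affine x y) (Affine x' y') <->
  (forall a b, root_pair a b -> near w (x - a) (x' - b)) /\ near w (y / k) (y' / k').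
Proof.
split=> [[h1 h2 h3 hy]|[h hy]]; first by split=> // a b [] [-> ->].
by split=> //; apply: h; [apply: Or31|apply: Or32|apply: Or33].
Qed.

Lemma corresp_conj n P P' : M n P P' -> M n (map_point s P) (map_point s P').
Proof.
elim: n P P' => [|n IH] P P'; first by case=> -> ->.
case=> oP oP' h hM; split; try exact: map_point_on; last first.
  by rewrite -!map_point_add //; apply: IH.
case: P P' h {oP oP' hM} => [|x y] [|x' y'] // /near_point_pairs[h hy].
apply/near_point_pairs; split=> [a b /s_pairs[a0 [b0 [/h h0 <- <-]]]|].
  by rewrite -!rmorphB; apply: near_conj.
move: (near_conj hy); rewrite !fmorph_div; case: s_scalars => -[-> ->] //.
by rewrite !invrN !mulrN => /near_opp; rewrite !opprK.
Qed.
End Equivariance.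

(** * Roots of congruent cubics *)

Lemma residue_two (K L : fieldType) (iota : {rmorphism K -> L})
    (v : K -> \bar int) (w : L -> \bar rat) (p : nat) :
  extends_valuation iota v w -> residue_char v p -> odd p -> ~~ (0 < w 2%R)%E.
Proof.
move=> [vw ext] [_ vp] odd_p; apply/negP => h.
have wp : (0 < w p%:R%R)%E.
  rewrite -(rmorph_nat iota) ext; move: vp.
  by case: (v _) => //= n; rewrite !lte_fin ltr0z.
(* As p is odd, p and 2 cannot both lie in the maximal ideal. *)
have e : 1 = p%:R - 2 * (p./2)%:R :> L.
  rewrite -{1}(odd_double_half p) odd_p natrD -muln2 natrM mulr1n; ring.
have : (0 < w 1%R)%E.
  by rewrite e; apply: valB_gt => //; apply: valM_gt0 => //; apply: val_nat_ge0.
by rewrite valuation1 // ltxx.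
Qed.

Lemma monic_cubic_split (L : closedFieldType) (f : {poly L}) :
  f \is monic -> size f = 4%N ->
  exists a1 a2 a3, f = ('X - a1%:P) * ('X - a2%:P) * ('X - a3%:P).
Proof.
move=> /monicP mf; have [rs ->] := closed_field_poly_normal f.
rewrite mf scale1r size_prod_XsubC => -[].
case: rs => [|a1 [|a2 [|a3 []]]] // _; exists a1, a2, a3.
by rewrite !big_cons big_nil mulr1 mulrA.
Qed.

Lemma elliptic_roots (L : closedFieldType) (k a1 a2 a3 : L) :
  elliptic (cubic k a1 a2 a3) -> [/\ a1 != a2, a1 != a3 & a2 != a3].
Proof.
case=> _ sm; split; apply/eqP => e.
- by case: (sm a1 0); rewrite ?cubicE ?cubic_deriv e ?mul0rn; [ring | split=> //; ring].
- by case: (sm a1 0); rewrite ?cubicE ?cubic_deriv e ?mul0rn; [ring | split=> //; ring].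
- by case: (sm a2 0); rewrite ?cubicE ?cubic_deriv e ?mul0rn; [ring | split=> //; ring].
Qed.

Section Roots.
Variables (F : fieldType) (R : realDomainType) (w : F -> \bar R).
Hypothesis vw : valuation w.

Lemma horner_val_ge0 (f : {poly F}) x :
  (forall i, 0 <= w f`_i)%E -> (0 <= w x)%E -> (0 <= w f.[x])%E.
Proof.
move=> hf hx; rewrite horner_coef; apply: val_sum_ge => // i _.
apply: valM_ge0 => //; elim: (nat_of_ord i) => [|n IH]; first by rewrite expr0 valuation1.
by rewrite exprS valM_ge0.
Qed.

Lemma deriv_val_ge0 (f : {poly F}) :
  (forall i, 0 <= w f`_i)%E -> (forall i, 0 <= w f^`()`_i)%E.
Proof.
move=> hf i; rewrite coef_deriv -mulr_natr.
by apply: valM_ge0 => //; apply: val_nat_ge0.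
Qed.

Lemma monic_root_val_ge0 (f : {poly F}) x :
  f \is monic -> (forall i, 0 <= w f`_i)%E -> root f x -> (0 <= w x)%E.
Proof.
move=> /monicP mf hf /rootP fx; rewrite leNgt; apply/negP => neg.
have x0 : x != 0 by apply: contraTneq neg => ->; rewrite (Defs.val0 vw) ltNge leey.
have wV : (0 < w x^-1)%E by rewrite valuationV // oppe_gt0.
have f0 : f != 0 by rewrite -lead_coef_eq0 mf oner_eq0.
have [n sf] : exists n, size f = n.+1.
  by exists (size f).-1; rewrite prednK // size_poly_gt0.
(* This is f(x) = 0 divided by x^n; if x were not integral, every term on the right would have
   positive valuation. *)
have e : 1 = - \sum_(i < n) f`_i * x^-1 ^+ (n - i).
  apply/eqP; rewrite -addr_eq0; apply/eqP.
  have : f.[x] * x^-1 ^+ n = 0 by rewrite fx mul0r.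
  rewrite horner_coef sf big_ord_recr /= mulrDl mulr_suml.
  have -> : f`_n = 1 by rewrite -mf lead_coefE sf.
  rewrite mul1r -exprMn mulfV // expr1n => sum0; rewrite addrC -[RHS]sum0; congr (_ + _).
  apply: eq_bigr => i _.
  have -> : x^-1 ^+ n = x^-1 ^+ i * x^-1 ^+ (n - i).
    by rewrite -exprD subnKC // ltnW.
  by rewrite mulrA -(mulrA f`_i) -exprMn mulfV // expr1n mulr1.
have : (0 < w 1%R)%E.
  rewrite e valuationN //; elim/big_ind: _ => [|y z hy hz|i _].
  - by rewrite (Defs.val0 vw) ltry.
  - exact: valD_gt.
  rewrite mulrC; apply: valM_gt0 => //.
  have : (0 < n - i)%N by rewrite subn_gt0.
  case: (n - i)%N => // m _; rewrite exprS; apply: valM_gt0 => //.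
  elim: m => [|m IH]; first by rewrite expr0 valuation1.
  by rewrite exprS valM_ge0 // ltW.
by rewrite valuation1 // ltxx.
Qed.

(* Newton's argument: f2 and its derivative at r are close to f1(r) = 0 and
   f1'(r), and f2'(r) is the sum of the quotients of f2(r) by its factors. *)
Lemma close_root (f1 f2 h : {poly F}) c r z1 z2 z3 (N d : R) :
  f2 = ('X - z1%:P) * ('X - z2%:P) * ('X - z3%:P) -> f1 - f2 = c *: h ->
  (forall i, 0 <= w h`_i)%E -> (0 <= w r)%E -> root f1 r -> w c = N%:E -> 0 <= d ->
  (w f1^`().[r] < (N - d)%:E)%E ->
  [\/ (d%:E < w (r - z1)%R)%E, (d%:E < w (r - z2)%R)%E | (d%:E < w (r - z3)%R)%E].
Proof.
move=> e2 e h0 r0 /rootP f1r wc d0 hd.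
have [?|n1] := boolP (d%:E < w (r - z1))%E; first by apply: Or31.
have [?|n2] := boolP (d%:E < w (r - z2))%E; first by apply: Or32.
have [?|n3] := boolP (d%:E < w (r - z3))%E; first by apply: Or33.
rewrite -!leNgt in n1 n2 n3.
have f2r : (r - z1) * (r - z2) * (r - z3) = - (c * h.[r]).
  have <- : f2.[r] = (r - z1) * (r - z2) * (r - z3) by rewrite e2 !hornerM !hornerXsubC.
  have -> : f2 = f1 - c *: h by rewrite -e subKr.
  by rewrite hornerD hornerN hornerZ f1r sub0r.
have chN x : (0 <= w x)%E -> (N%:E <= w (c * x)%R)%E.
  by move=> hx; rewrite (Defs.valM vw) wc leeDl.
have pN x y : (w y <= d%:E)%E -> (N%:E <= w (x * y)%R)%E -> ((N - d)%:E <= w x)%E.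
  rewrite (Defs.valM vw); case: (w x) => [a| |]; case: (w y) => [b| |] //=; rewrite ?leey //.
  by rewrite -EFinD !lee_fin lerBlDr => h1 h2; apply: le_trans h2 _; rewrite lerD2l.
have hN : (N%:E <= w ((r - z1) * (r - z2) * (r - z3))%R)%E.
  by rewrite f2r valuationN // chN // horner_val_ge0.
have hf : f1^`().[r] = (r - z1) * (r - z2) + (r - z1) * (r - z3) + (r - z2) * (r - z3)
    + c * h^`().[r].
  have -> : f1 = f2 + c *: h by rewrite -e addrC subrK.
  rewrite derivD derivZ hornerD hornerZ e2 !derivM !derivXsubC !mulr1 !mul1r.
  by rewrite !(hornerXsubC, hornerM, hornerD); ring.
(* With no root of f2 beyond d, omitting one factor from f2(r) costs at most d, so all terms of
   f1'(r) have valuation at least N - d. *)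
move: hd; rewrite ltNge => /negP[]; rewrite hf.
apply: valD_ge => //; [apply: valD_ge => //; [apply: valD_ge => //|]|].
- exact: pN n3 hN.
- by apply: pN n2 _; rewrite mulrAC.
- by apply: pN n1 _; rewrite mulrC mulrA.
- apply: le_trans (chN _ _); first by rewrite lee_fin gerBl.
  by apply: horner_val_ge0 => //; apply: deriv_val_ge0.
Qed.
End Roots.

Lemma val_uniformiser_exp (K : fieldType) (v : K -> \bar int) (pi : K) (N : int) :
  valuation v -> v pi = 1%:E -> 0 <= N -> v (pi ^ N) = N%:E.
Proof.
move=> vv vpi; case: N => // n _; rewrite -exprnP.
elim: n => [|n IH]; first by rewrite expr0 valuation1.
by rewrite exprS (Defs.valM vv) IH vpi -EFinD -intS.
Qed.

Lemma integral_coef (K L : fieldType) (iota : {rmorphism K -> L})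
    (v : K -> \bar int) (w : L -> \bar rat) (f : {poly K}) :
  extends_valuation iota v w -> f \is a polyOver (valuation_ring v) ->
  forall i, (0 <= w (map_poly iota f)`_i)%E.
Proof.
move=> [vw ext]; rewrite qualifE /= => /allP hf i; rewrite coef_map /=.
have [lt|le] := ltnP i (size f); last by rewrite nth_default // rmorph0 (Defs.val0 vw) leey.
by rewrite (ext_ge ext 0); apply: hf; rewrite mem_nth.
Qed.

Lemma monic_prod_distinct (F : fieldType) (f : {poly F}) b1 b2 b3 :
  f \is monic -> size f = 4%N -> root f b1 -> root f b2 -> root f b3 ->
  b1 != b2 -> b1 != b3 -> b2 != b3 ->
  f = ('X - b1%:P) * ('X - b2%:P) * ('X - b3%:P).
Proof.
move=> /monicP mf sf r1 r2 r3 n12 n13 n23.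
rewrite [LHS](@all_roots_prod_XsubC _ f [:: b1; b2; b3]) ?uniq_rootsE //=.
- by rewrite mf scale1r !big_cons big_nil mulr1 mulrA.
- by rewrite r1 r2 r3.
- by rewrite !inE negb_or n12 n13 n23.
Qed.

Lemma max_root_dist_ge (L : closedFieldType) (w : L -> \bar rat) (f : {poly L}) r s :
  f != 0 -> root f r -> root f s -> r != s -> (w (r - s)%R <= max_root_dist w f)%E.
Proof.
move=> f0 hr hs ne; rewrite /max_root_dist.
apply: (@bigmax_sup_seq _ _ _ _ _ r xpredT) => //; first by rewrite mem_roots.
by apply: (@le_bigmax_seq _ _ _ _ _ s) => //; rewrite mem_roots.
Qed.

Lemma max_deriv_val_ge (L : closedFieldType) (w : L -> \bar rat) (f : {poly L}) r :
  f != 0 -> root f r -> (w f^`().[r] <= max_deriv_val w f)%E.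
Proof.
move=> f0 hr; rewrite /max_deriv_val.
by apply: (@le_bigmax_seq _ _ _ _ _ r xpredT) => //; rewrite mem_roots.
Qed.

Lemma root_pair_uniq (L : closedFieldType) (a1 a2 a3 b1 b2 b3 : L) :
  a1 != a2 -> a1 != a3 -> a2 != a3 -> forall a b c,
  root_pair a1 a2 a3 b1 b2 b3 a b -> root_pair a1 a2 a3 b1 b2 b3 a c -> b = c.
Proof.
move=> /eqP n12 /eqP n13 /eqP n23 a b c [] [-> ->] [] [e ->] //.
all: by first [case: n12; rewrite e; done|case: n13; rewrite e; done|case: n23; rewrite e; done].
Qed.

Lemma root_cubic (L : fieldType) (a1 a2 a3 x : L) :
  root (('X - a1%:P) * ('X - a2%:P) * ('X - a3%:P)) x =
  [|| x == a1, x == a2 | x == a3].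
Proof. by rewrite !rootM !root_XsubC orbA. Qed.

Theorem corollary3
  (K : fieldType) (v : K -> \bar int) (pi : K) (p : nat)
  (Kbar : closedFieldType) (iota : {rmorphism K -> Kbar})
  (w : Kbar -> \bar rat)
  (c1 c2 : K) (f1 f2 : {poly K}) (N : int)
  (K_complete : complete_discrete_valuation v pi)
  (p_residue_char : residue_char v p) (p_odd : odd p)
  (Kbar_closure : algebraic_closure iota)
  (w_extends : extends_valuation iota v w)
  (c1_neq0 : c1 != 0) (c2_neq0 : c2 != 0)
  (f1_integral : f1 \is a polyOver (valuation_ring v))
  (f2_integral : f2 \is a polyOver (valuation_ring v))
  (f1_monic : f1 \is monic) (f2_monic : f2 \is monic)
  (f1_cubic : size f1 = 4%N) (f2_cubic : size f2 = 4%N)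
  (E1_elliptic : elliptic (map_poly iota (c1 *: f1)))
  (E2_elliptic : elliptic (map_poly iota (c2 *: f2)))
  (c1_c2_square : exists2 u : K, u != 0 & c1 / c2 = u ^+ 2)
  (f1_f2_congr : congr_poly v (pi ^ N) f1 f2)
  (N_large : (max_root_dist w (map_poly iota f1) +
              max_deriv_val w (map_poly iota f1) < (N%:~R)%:E)%E) :
  tate2_isomorphic iota (map_poly iota (c1 *: f1)) (map_poly iota (c2 *: f2)).
Proof.
have vw := ext_valuation w_extends.
have w2 := residue_two w_extends p_residue_char p_odd.
case: c1_c2_square => u u0 eu; case: f1_f2_congr => h h_int eh.
set F1 := map_poly iota f1 in N_large; set F2 := map_poly iota f2.
have mF1 : F1 \is monic by rewrite map_monic.
have mF2 : F2 \is monic by rewrite map_monic.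
have sF1 : size F1 = 4%N by rewrite size_map_poly.
have sF2 : size F2 = 4%N by rewrite size_map_poly.
have F10 : F1 != 0 by apply: monic_neq0.
have [a1 [a2 [a3 eF1]]] := monic_cubic_split mF1 sF1.
have [z1 [z2 [z3 eF2]]] := monic_cubic_split mF2 sF2.
(* Tying k' to k by an element of K makes every Galois automorphism act on both by the same sign. *)
have [k ek] := closed_sqrt (iota c1); pose k' := k / iota u.
have iu0 : iota u != 0 by rewrite fmorph_eq0.
have k0 : k != 0 by rewrite -sqrf_eq0 ek fmorph_eq0.
have k0' : k' != 0 by rewrite mulf_neq0 ?invr_eq0.
have ek' : k' ^+ 2 = iota c2.
  rewrite expr_div_n ek -rmorphXn -eu /= -fmorph_div; congr (iota _); field.
  by rewrite c1_neq0 c2_neq0.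
have eg1 : map_poly iota (c1 *: f1) = cubic k a1 a2 a3.
  by rewrite map_polyZ -/F1 eF1 /cubic ek.
rewrite eg1 in E1_elliptic.
have [a12 a13 a23] := elliptic_roots E1_elliptic.
have r1 : root F1 a1 by rewrite eF1 root_cubic eqxx.
have r2 : root F1 a2 by rewrite eF1 root_cubic eqxx orbT.
have r3 : root F1 a3 by rewrite eF1 root_cubic eqxx !orbT.
have F1_int := integral_coef w_extends f1_integral.
have root_int r : root F1 r -> (0 <= w r)%E := monic_root_val_ge0 vw mF1 F1_int.
have dist_le := max_root_dist_ge w F10.
have deriv_le := max_deriv_val_ge w F10.
have n12 : a1 - a2 != 0 by rewrite subr_eq0.
have n13 : a1 - a3 != 0 by rewrite subr_eq0.
have d1 : F1^`().[a1] = (a1 - a2) * (a1 - a3).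
  by rewrite eF1 !derivM !derivXsubC !mulr1 !mul1r !(hornerXsubC, hornerM, hornerD); ring.
(* The value w(a1 - a2) bounds the maximum from below and excludes [-oo]. As the derivative term is
   not [-oo] either, [+oo] would contradict [N_large]. *)
have [d ed] : exists d : rat, max_root_dist w F1 = d%:E.
  have := deriv_le _ r1; rewrite d1 (val_fine vw (mulf_neq0 n12 n13)).
  have := dist_le _ _ r1 r2 a12; rewrite (val_fine vw n12).
  move: N_large; case: (max_root_dist w F1) => [d| |] //; first by exists d.
  by case: (max_deriv_val w F1).
rewrite ed in dist_le N_large.
have d0 : 0 <= d.
  rewrite -lee_fin; apply: le_trans (dist_le _ _ r1 r2 a12).
  by apply: valB_ge => //; apply: root_int.
have derivN r : root F1 r -> (w F1^`().[r] < (N%:~R - d)%:E)%E.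
  move/deriv_le => le; apply: le_lt_trans le _.
  by move: N_large; case: (max_deriv_val w F1) => [e| |] //=;
    rewrite ?ltNyr // !lte_fin ltrBrDl.
(* The exponent is an integer; its sign follows from the integrality of f1'(a1) and from d >= 0. *)
have N0 : 0 <= N.
  have : (0 <= w F1^`().[a1])%E.
    by apply: horner_val_ge0 (deriv_val_ge0 vw F1_int) _ => //; apply: root_int.
  move=> /le_lt_trans /(_ (derivN _ r1)); rewrite lte_fin subr_gt0 => lt.
  by rewrite -(ler_int rat) ltW // (le_lt_trans d0).
have wc : w (iota (pi ^ N)) = (N%:~R)%:E.
  rewrite (ext_restrict w_extends) (val_uniformiser_exp _ _ N0) //.
    exact: cdv_valuation K_complete.
  exact: cdv_uniformiser K_complete.
have eF : F1 - F2 = iota (pi ^ N) *: map_poly iota h.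
  by rewrite /F1 /F2 -rmorphB eh /= map_polyZ.
have close r : root F1 r -> exists2 b, root F2 b & (d%:E < w (r - b)%R)%E.
  move=> hr; have [c|c|c] := close_root vw eF2 eF (integral_coef w_extends h_int)
    (root_int _ hr) hr wc d0 (derivN _ hr).
  - by exists z1; rewrite // eF2 root_cubic eqxx.
  - by exists z2; rewrite // eF2 root_cubic eqxx orbT.
  - by exists z3; rewrite // eF2 root_cubic eqxx !orbT.
(* As d is the maximum over distinct roots, no b can be closer than d to two of them. So b1, b2, b3
   are distinct and exhaust the roots of f2. *)
have close_uniq r s b : root F1 r -> root F1 s ->
    (d%:E < w (r - b)%R)%E -> (d%:E < w (s - b)%R)%E -> r = s.
  move=> hr hs h1 h2; apply/eqP; apply: contraT => ne.
  have := dist_le _ _ hr hs ne; rewrite leNgt => /negP[].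
  have -> : r - s = (r - b) - (s - b) by ring.
  exact: valB_gt.
have [b1 rb1 ab1] := close _ r1; have [b2 rb2 ab2] := close _ r2.
have [b3 rb3 ab3] := close _ r3.
have b12 : b1 != b2.
  by apply: contraNneq a12 => e; rewrite -e in ab2; apply/eqP/(close_uniq _ _ b1).
have b13 : b1 != b3.
  by apply: contraNneq a13 => e; rewrite -e in ab3; apply/eqP/(close_uniq _ _ b1).
have b23 : b2 != b3.
  by apply: contraNneq a23 => e; rewrite -e in ab3; apply/eqP/(close_uniq _ _ b2).
have {}eF2 := monic_prod_distinct mF2 sF2 rb1 rb2 rb3 b12 b13 b23.
have eg2 : map_poly iota (c2 *: f2) = cubic k' b1 b2 b3.
  by rewrite map_polyZ -/F2 eF2 /cubic ek'.
have nr r s b c : root F1 r -> root F1 s -> r != s -> (d%:E < w (r - b)%R)%E ->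
    (d%:E < w (s - c)%R)%E -> near w (r - s) (b - c).
  move=> hr hs ne h1 h2; apply: (near_sym vw); apply: (near_close vw).
    by rewrite subr_eq0.
  apply: le_lt_trans (dist_le _ _ hr hs ne) _.
  have -> : b - c - (r - s) = (s - c) - (r - b) by ring.
  exact: valB_gt.
have fixed (s : absolute_galois iota) f : map_poly s (map_poly iota f) = map_poly iota f.
  by apply/polyP => i; rewrite !coef_map /= gal_fix.
have pairP a : root F1 a -> exists2 b, root_pair a1 a2 a3 b1 b2 b3 a b &
    root F2 b /\ (d%:E < w (a - b)%R)%E.
  rewrite {1}eF1 root_cubic => /or3P[] /eqP ->.
  - by exists b1; first exact: Or31.
  - by exists b2; first exact: Or32.
  - by exists b3; first exact: Or33.
have pairQ b : root F2 b -> exists2 a, root_pair a1 a2 a3 b1 b2 b3 a b &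
    root F1 a /\ (d%:E < w (a - b)%R)%E.
  rewrite {1}eF2 root_cubic => /or3P[] /eqP ->.
  - by exists a1; first exact: Or31.
  - by exists a2; first exact: Or32.
  - by exists a3; first exact: Or33.
have pairs (s : absolute_galois iota) a b : root_pair a1 a2 a3 b1 b2 b3 a b ->
    exists a0 b0, [/\ root_pair a1 a2 a3 b1 b2 b3 a0 b0, s a0 = a & s b0 = b].
  move=> ab; have ra : root F1 a by case: (ab) => -[-> _].
  have [t _ ts] := gal_bij s.
  have rt : root F1 (t a).
    by rewrite /root -(fmorph_eq0 s) (fixed_horner (fixed s f1)) ts.
  (* Take b0 close to the preimage of a. Since s preserves w, s b0 is a root of f2 close to a, and
     closeness determines the pairing. *)
  have [b0 ab0 [rb0 hb0]] := pairP _ rt.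
  have [a' ab' [ra' ha']] : exists2 a', root_pair a1 a2 a3 b1 b2 b3 a' (s b0) &
      root F1 a' /\ (d%:E < w (a' - s b0)%R)%E.
    apply: pairQ; rewrite /root -(fixed_horner (fixed s f2)) fmorph_eq0.
    exact: rb0.
  have hs : (d%:E < w (a - s b0)%R)%E.
    by rewrite -{1}(ts a) -rmorphB (gal_val _ _ K_complete w_extends Kbar_closure).
  exists (t a), b0; split=> //.
  rewrite -(close_uniq _ _ _ ra ra' hs ha') in ab'.
  exact: root_pair_uniq ab' ab.
rewrite eg1 eg2; apply: (tate2_isomorphic_corresp vw w2 k0 k0' a12 a13 a23); try exact: nr.
- move=> s n P P'; apply: corresp_conj.
  + by move=> x; apply: gal_val K_complete w_extends Kbar_closure.
  + by rewrite -eg1 fixed.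
  + by rewrite -eg2 fixed.
  + exact: pairs.
  + have sk' : s k' = s k / iota u by rewrite fmorph_div gal_fix.
    have : s k ^+ 2 == k ^+ 2 by rewrite -rmorphXn ek /= gal_fix.
    by rewrite eqf_sqr sk' => /orP[] /eqP ->; [left | right; rewrite mulNr].
- move=> s P; rewrite -eg1; apply: map_point_tate2; exact: fixed.
Qed.
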